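(* The assignment $\varphi\mapsto\varprojlim\varphi_k$ defines a representation (group homomorphism) $\mathrm{Out}(F_n)\to\mathrm{Aut}\left(\varprojlim\tilde M_k\right)$, and this representation is faithful (injective).
   Context: Let $F_n$ be a free group with basis $X$, $|X|=n$. Graphs are in the sense of Serre (edges come with a fixed-point-free inversion $e\mapsto\bar e$). An $X$-labeled graph has edges labeled by $X\cup X^{-1}$ so that $\bar e$ carries the inverse label; morphisms preserve labels; it is folded if distinct edges with the same initial vertex have distinct labels. A u-word (unoriented word) is a folded labeled graph homeomorphic to a compact line segment, up to isomorphism (equivalently, a reduced word $u\neq1$ up to inversion, $\overline u=\overline{u^{-1}}$); its length $l(u)$ is its number of unoriented edges. A cyclic word is a folded labeled graph homeomorphic to a circle, up to isomorphism (equivalently, a nontrivial cyclically reduced word up to cyclic permutation and inversion). $\mathrm{Hom}(u,w)$ is the set of labeled graph morphisms $u\to w$ (not necessarily injective). $W_k$ is the set of u-words of length $k$, $M_k$ is the free $\mathbb Z$-module on $W_k$, $C$ is the set of cyclic words and $\mathbb Z[C]$ is the free $\mathbb Z$-module on $C$. The homomorphism $\pi_k:\mathbb Z[C]\to M_k$ is defined by $\pi_k(w)=\sum_{u\in W_k}|\mathrm{Hom}(u,w)|\,u$ for $w\in C$. Put $\tilde M_k=\mathrm{Im}\,\pi_k$. For $k\geq 2$ there is a unique homomorphism $p_k:\tilde M_k\to\tilde M_{k-1}$ with $p_k\circ\pi_k=\pi_{k-1}$; $\varprojlim\tilde M_k$ is the inverse limit of the system $(\tilde M_k,p_k)_k$,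 i.e. sequences $(v_k)_{k\geq1}$ with $v_k\in\tilde M_k$ and $p_k(v_k)=v_{k-1}$. An automorphism $\varphi$ of $F_n$ acts on $C$ ($\varphi(w)$ is the cyclic word given by the cyclic reduction of $\varphi$ of a representative of $w$), and hence linearly on $\mathbb Z[C]$. For every u-word $u$ there is a finite multiset $S_{u,\varphi}$ of u-words with $|\mathrm{Hom}(u,\varphi(w))|=\sum_{v\in S_{u,\varphi}}|\mathrm{Hom}(v,w)|$ for all cyclic words $w$ (one such multiset is fixed for each $u$ and $\varphi$; the limit map below does not depend on which multiset with this property is used). Set $m_k=m_k^\varphi=\max_{u\in W_k}\max_{v\in S_{u,\varphi}}l(v)$. Then there is a unique homomorphism $\varphi_k:\tilde M_{m_k}\to\tilde M_k$ satisfying $\varphi_k\circ\pi_{m_k}=\pi_k\circ\varphi$. The map $\varprojlim\varphi_k:\varprojlim\tilde M_k\to\varprojlim\tilde M_k$ is $(v_i)_i\mapsto(\varphi_k(v_{m_k}))_k$. It depends only on the class of $\varphi$ in $\mathrm{Out}(F_n)$.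
   Formalization: The case n = 1 is excluded: Out(F_1) = Z/2 is generated by inversion x -> x^{-1}, which fixes every (unoriented) cyclic word, so the representation is not faithful there. *)

(* Defs.v *)
From HB Require Import structures.
From mathcomp Require Import all_boot all_algebra generic_quotient.
From mathcomp Require Import boolp freeg.

Set Implicit Arguments.
Unset Strict Implicit.
Unset Printing Implicit Defensive.

Import GRing.Theory.

Local Open Scope quotient_scope.

Section Sym.
Variable T : choiceType.

Record sym := Sym { sym_fun :> T -> T; _ : `[< bijective sym_fun >] }.
HB.instance Definition _ := [isSub for sym_fun].
HB.instance Definition _ := [Choice of sym by <:].

Lemma sym_bij (f : sym) : bijective f.
Proof. exact/asboolP/(valP f). Qed.

Lemma symP (f g : sym) : f =1 g -> f = g.
Proof. by move=> fg; apply: val_inj; apply: funext. Qed.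

Definition mk_sym (f : T -> T) (fB : bijective f) : sym :=
  Sub f (introT (asboolP _) fB).

(* The product of symmetries and automorphisms is composition. *)
Definition sym_mul (f g : sym) : sym :=
  mk_sym (bij_comp (sym_bij f) (sym_bij g)).

Definition sym_one : sym := mk_sym (Bijective (frefl id) (frefl id)).

Lemma sym_inv_ex (f : sym) : exists g : T -> T, cancel f g /\ cancel g f.
Proof. by case: (sym_bij f) => g fK gK; exists g. Qed.

Definition sym_inv (f : sym) : sym :=
  let fgK := projT2 (cid (sym_inv_ex f)) in
  mk_sym (Bijective (proj2 fgK) (proj1 fgK)).

Lemma sym_mulA : associative sym_mul.
Proof. by move=> f g h; apply: symP. Qed.

Lemma sym_mul1 : left_id sym_one sym_mul.
Proof. by move=> f; apply: symP. Qed.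

Lemma sym_1mul : right_id sym_one sym_mul.
Proof. by move=> f; apply: symP. Qed.

Lemma sym_mulV : left_inverse sym_one sym_inv sym_mul.
Proof.
by move=> f; apply: symP => x; exact: (proj1 (projT2 (cid (sym_inv_ex f)))).
Qed.

Lemma sym_Vmul : right_inverse sym_one sym_inv sym_mul.
Proof.
by move=> f; apply: symP => x; exact: (proj2 (projT2 (cid (sym_inv_ex f)))).
Qed.

HB.instance Definition _ :=
  isGroup.Build sym sym_mulA sym_mul1 sym_1mul sym_mulV sym_Vmul.

Lemma symM (f g : sym) x : (f * g)%g x = f (g x). Proof. by []. Qed.
Lemma sym1 x : (1%g : sym) x = x. Proof. by []. Qed.
Lemma symK (f : sym) : cancel f (f^-1)%g.
Proof. by move=> x; rewrite -symM mulVg. Qed.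
Lemma symVK (f : sym) : cancel (f^-1)%g f.
Proof. by move=> x; rewrite -symM mulgV. Qed.

End Sym.

Section GroupAut.
Variable G : groupType.

Definition is_group_aut : pred (sym G) :=
  fun f => `[< {morph f : x y / (x * y)%g} >].

Record group_aut := GroupAut { aut_sym :> sym G; _ : is_group_aut aut_sym }.
HB.instance Definition _ := [isSub for aut_sym].
HB.instance Definition _ := [Choice of group_aut by <:].

Lemma is_group_aut_closed : group_closed is_group_aut.
Proof.
split=> [|f g]; first by apply/asboolP.
move=> /asboolP fM /asboolP gM; apply/asboolP => x y.
have gVM : {morph (g^-1)%g : x y / (x * y)%g}.
  by move=> u v; rewrite -[u in LHS](symVK g) -[v in LHS](symVK g) -gM symK.
by rewrite !symM gVM fM.
Qed.

HB.instance Definition _ :=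
  SubChoice_isSubGroup.Build (sym G) is_group_aut group_aut is_group_aut_closed.

Lemma group_autM (f : group_aut) : {morph f : x y / (x * y)%g}.
Proof. exact/asboolP/(valP f). Qed.

Lemma group_autP (f g : group_aut) : f =1 g -> f = g.
Proof. by move=> fg; apply/val_inj/symP. Qed.

Lemma group_aut_inj (f : group_aut) : injective f.
Proof. exact/bij_inj/sym_bij. Qed.

Definition inner_fun (g : G) (x : G) : G := (g * x * g^-1)%g.

Lemma inner_fun_bij g : bijective (inner_fun g).
Proof.
exists (inner_fun g^-1) => x; rewrite /inner_fun invgK !mulgA.
  by rewrite mulVg mul1g -mulgA mulVg mulg1.
by rewrite mulgV mul1g -mulgA mulgV mulg1.
Qed.

Lemma inner_fun_aut g : is_group_aut (mk_sym (inner_fun_bij g)).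
Proof. by apply/asboolP => x y; rewrite /= /inner_fun !mulgA mulgVK. Qed.

Definition inner (g : G) : group_aut := Sub _ (inner_fun_aut g).

Definition is_inner : pred group_aut := fun f => `[< exists g, f = inner g >].

(* Out(G) = Aut(G) / Inn(G): f and g are identified when f g^-1 is inner. *)
Definition out_eq : rel group_aut := fun f g => is_inner (f * g^-1)%g.

Lemma is_inner1 : is_inner 1%g.
Proof.
apply/asboolP; exists 1%g; apply: group_autP => x.
by rewrite /= /inner_fun mul1g invg1 mulg1.
Qed.

Lemma is_innerM f g : is_inner f -> is_inner g -> is_inner (f * g)%g.
Proof.
move=> /asboolP[a ->] /asboolP[b ->]; apply/asboolP; exists (a * b)%g.
by apply: group_autP => x; rewrite /= /inner_fun invgM !mulgA.
Qed.

Lemma is_innerV f : is_inner f -> is_inner f^-1%g.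
Proof.
move=> /asboolP[a ->]; apply/asboolP; exists a^-1%g.
apply: (mulgI (inner a)); rewrite mulgV; apply: group_autP => x.
rewrite /= /inner_fun /= invgK !mulgA mulgV mul1g -mulgA mulgV mulg1.
by [].
Qed.

Lemma is_innerJ f g : is_inner f -> is_inner (g * f * g^-1)%g.
Proof.
move=> /asboolP[a ->]; apply/asboolP; exists (g a).
apply: (canLR (mulgK g)); apply: group_autP => x.
have gV : g a^-1%g = (g a)^-1%g.
  apply: (mulgI (g a)); rewrite mulgV -group_autM mulgV.
  by apply: (mulgI (g 1%g)); rewrite -group_autM !mulg1.
change (g (inner_fun a x) = inner_fun (g a) (g x)).
by rewrite /inner_fun !group_autM gV.
Qed.

Lemma out_eq_refl : reflexive out_eq.
Proof. by move=> f; rewrite /out_eq mulgV is_inner1. Qed.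

Lemma out_eq_sym : symmetric out_eq.
Proof.
by move=> f g; apply/idP/idP => /is_innerV; rewrite invgM invgK.
Qed.

Lemma out_eq_trans : transitive out_eq.
Proof.
move=> g f h fg gh; have := is_innerM fg gh.
by rewrite mulgA mulgVK.
Qed.

Canonical out_equiv := EquivRel out_eq out_eq_refl out_eq_sym out_eq_trans.

Definition group_out := {eq_quot out_eq}.
HB.instance Definition _ := Choice.on group_out.
HB.instance Definition _ := EqQuotient.on group_out.

Definition out_class (f : group_aut) : group_out := \pi_group_out f.

Lemma out_classP (f g : group_aut) :
  reflect (out_class f = out_class g) (is_inner (f * g^-1)%g).
Proof.
apply: (iffP idP) => [fg|].
  by apply/eqmodP.
by move/eqmodP.
Qed.

Definition out_mul (a b : group_out) : group_out :=
  out_class (repr a * repr b)%g.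
Definition out_inv (a : group_out) : group_out := out_class (repr a)^-1%g.
Definition out_one : group_out := out_class 1%g.

Lemma out_class_repr (a : group_out) : out_class (repr a) = a.
Proof. exact: reprK. Qed.

Lemma out_classM f g : out_class (f * g)%g = out_mul (out_class f) (out_class g).
Proof.
apply/out_classP.
have /out_classP Hf := esym (out_class_repr (out_class f)).
have /out_classP Hg := esym (out_class_repr (out_class g)).
have := is_innerM (is_innerJ f Hg) Hf.
by rewrite invgM !mulgA !mulgVK.
Qed.

Lemma out_classV f : out_class f^-1%g = out_inv (out_class f).
Proof.
apply/out_classP.
have /out_classP Hf := out_class_repr (out_class f).
by have := is_innerJ f^-1%g Hf; rewrite !invgK !mulgA mulgVK.
Qed.

Lemma out_mulA : associative out_mul.
Proof.
move=> a b c; rewrite -(out_class_repr a) -(out_class_repr b).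
by rewrite -(out_class_repr c) -!out_classM mulgA.
Qed.

Lemma out_mul1 : left_id out_one out_mul.
Proof. by move=> a; rewrite -(out_class_repr a) -out_classM mul1g. Qed.

Lemma out_1mul : right_id out_one out_mul.
Proof. by move=> a; rewrite -(out_class_repr a) -out_classM mulg1. Qed.

Lemma out_mulV : left_inverse out_one out_inv out_mul.
Proof.
by move=> a; rewrite -(out_class_repr a) -out_classV -out_classM mulVg.
Qed.

Lemma out_Vmul : right_inverse out_one out_inv out_mul.
Proof.
by move=> a; rewrite -(out_class_repr a) -out_classV -out_classM mulgV.
Qed.

HB.instance Definition _ :=
  isGroup.Build group_out out_mulA out_mul1 out_1mul out_mulV out_Vmul.

End GroupAut.

Section ZmodAut.
Variable V : zmodType.

Definition is_zmod_aut : pred (sym V) :=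
  fun f => `[< {morph f : x y / (x + y)%R} >].

Record zmod_aut := ZmodAut { zaut_sym :> sym V; _ : is_zmod_aut zaut_sym }.
HB.instance Definition _ := [isSub for zaut_sym].
HB.instance Definition _ := [Choice of zmod_aut by <:].

Lemma is_zmod_aut_closed : group_closed is_zmod_aut.
Proof.
split=> [|f g]; first by apply/asboolP.
move=> /asboolP fD /asboolP gD; apply/asboolP => x y.
have gVD : {morph (g^-1)%g : x y / (x + y)%R}.
  by move=> u v; rewrite -[u in LHS](symVK g) -[v in LHS](symVK g) -gD symK.
by rewrite !symM gVD fD.
Qed.

HB.instance Definition _ :=
  SubChoice_isSubGroup.Build (sym V) is_zmod_aut zmod_aut is_zmod_aut_closed.

End ZmodAut.

Section FreeGroup.
Variable X : finType.

(* (x, true) stands for x and (x, false) for its inverse. *)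
Definition letter : Type := X * bool.
HB.instance Definition _ := Finite.on letter.

Definition linv (a : letter) : letter := (a.1, ~~ a.2).

Lemma linvK : involutive linv.
Proof. by case=> x b; rewrite /linv /= negbK. Qed.

Lemma linv_neq a : (linv a == a) = false.
Proof. by case: a => x b; rewrite /linv xpair_eqE eqxx; case: b. Qed.

Definition word_reduced (u : seq letter) : bool :=
  sorted (fun a b => b != linv a) u.

Definition cons_letter (a : letter) (u : seq letter) : seq letter :=
  if u is b :: u' then if b == linv a then u' else a :: u else [:: a].

(* The reduced form of u ++ v when v is reduced. *)
Definition reduce_cat (u v : seq letter) : seq letter :=
  foldr cons_letter v u.

Definition winv (u : seq letter) : seq letter := rev (map linv u).

Lemma reduced_behead a u : word_reduced (a :: u) -> word_reduced u.
Proof. by rewrite /word_reduced /=; apply: path_sorted. Qed.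

Lemma cons_letter_reduced a u : word_reduced u -> word_reduced (cons_letter a u).
Proof.
case: u => [|b u] //= Hu; case: ifPn => ba.
  exact: reduced_behead Hu.
by rewrite /word_reduced /= ba.
Qed.

Lemma reduce_cat_reduced u v : word_reduced v -> word_reduced (reduce_cat u v).
Proof. by move=> Hv; elim: u => //= a u; apply: cons_letter_reduced. Qed.

Lemma cons_letterK a u :
  word_reduced u -> cons_letter (linv a) (cons_letter a u) = u.
Proof.
case: u => [|b u] /=; first by rewrite linvK eqxx.
case: ifPn => [/eqP -> | ba _]; last by rewrite /= linvK eqxx.
case: u => [|c u] //; rewrite /word_reduced /= linvK => /andP[ca _].
by rewrite (negPf ca).
Qed.

Lemma cons_letterVK a u :
  word_reduced u -> cons_letter a (cons_letter (linv a) u) = u.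
Proof. by move=> Hu; rewrite -[a in cons_letter a]linvK cons_letterK. Qed.

Lemma reduce_cat_cons a u v : word_reduced v ->
  reduce_cat (cons_letter a u) v = cons_letter a (reduce_cat u v).
Proof.
move=> Hv; case: u => [|b u] //=; case: ifPn => [/eqP -> | //].
by rewrite cons_letterVK // reduce_cat_reduced.
Qed.

Lemma reduce_catA u v w : word_reduced w ->
  reduce_cat u (reduce_cat v w) = reduce_cat (reduce_cat u v) w.
Proof. by move=> Hw; elim: u => //= a u ->; rewrite reduce_cat_cons. Qed.

Lemma reduce_cat0 u : word_reduced u -> reduce_cat u [::] = u.
Proof.
elim: u => //= a u IHu au; rewrite IHu ?(reduced_behead au) //.
by move: au; case: u {IHu} => //= b u; rewrite /word_reduced /= => /andP[/negPf ->].
Qed.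

Lemma winvK : involutive winv.
Proof. by move=> u; rewrite /winv map_rev revK mapK //; exact: linvK. Qed.

Lemma reduced_winv u : word_reduced u -> word_reduced (winv u).
Proof.
rewrite /word_reduced /winv rev_sorted sorted_map; apply: sub_sorted => a b /=.
by apply: contra => /eqP ->; rewrite !linvK.
Qed.

Lemma reduce_cat_winv u : word_reduced u -> reduce_cat (winv u) u = [::].
Proof.
elim: u => //= a u IHu au; rewrite /winv /= rev_cons -cats1 /reduce_cat.
rewrite foldr_cat /= linvK eqxx; exact: IHu (reduced_behead au).
Qed.

(* Reduced words, multiplied by reducing the concatenation. *)
Record free_group := FreeGroup { fword :> seq letter; _ : word_reduced fword }.
HB.instance Definition _ := [isSub for fword].
HB.instance Definition _ := [Choice of free_group by <:].

Definition free_mul (u v : free_group) : free_group :=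
  Sub (reduce_cat (val u) (val v)) (reduce_cat_reduced _ (valP v)).
Definition free_inv (u : free_group) : free_group :=
  Sub (winv (val u)) (reduced_winv (valP u)).
Definition free_one : free_group := Sub [::] isT.

Lemma free_mulA : associative free_mul.
Proof. by move=> u v w; apply/val_inj/reduce_catA/(valP w). Qed.

Lemma free_mul1 : left_id free_one free_mul.
Proof. by move=> u; apply: val_inj. Qed.

Lemma free_1mul : right_id free_one free_mul.
Proof. by move=> u; apply/val_inj/reduce_cat0/(valP u). Qed.

Lemma free_mulV : left_inverse free_one free_inv free_mul.
Proof. by move=> u; apply/val_inj/reduce_cat_winv/(valP u). Qed.

Lemma free_Vmul : right_inverse free_one free_inv free_mul.
Proof.
move=> u; apply: val_inj; rewrite /= -{1}(winvK (val u)).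
exact/reduce_cat_winv/reduced_winv/(valP u).
Qed.

HB.instance Definition _ :=
  isGroup.Build free_group free_mulA free_mul1 free_1mul free_mulV free_Vmul.

End FreeGroup.

Record lgraph (X : finType) := LGraph {
  vertex : finType;
  edge : finType;
  origin : edge -> vertex;
  erev : edge -> edge;
  label : edge -> letter X;
  _ : involutive erev;
  _ : forall e, erev e != e;
  _ : forall e, label (erev e) = linv (label e) }.

Section Graphs.
Variable X : finType.
Implicit Types G H K : lgraph X.

Definition folded G : bool :=
  [forall e : edge G, forall e' : edge G,
    (origin e == origin e') && (label e == label e') ==> (e == e')].

Definition gmap G H : finType :=
  ({ffun vertex G -> vertex H} * {ffun edge G -> edge H})%type.

Definition is_ghom G H (f : gmap G H) : bool :=
  [forall e : edge G,
    [&& f.1 (origin e) == origin (f.2 e), f.2 (erev e) == erev (f.2 e)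
      & label (f.2 e) == label e]].

Definition Hom G H : {set gmap G H} := [set f | is_ghom f].

Definition giso G H : bool :=
  [exists f in Hom G H, exists g in Hom H G,
    [&& [forall x, g.1 (f.1 x) == x], [forall e, g.2 (f.2 e) == e],
        [forall x, f.1 (g.1 x) == x] & [forall e, f.2 (g.2 e) == e]]].

Lemma gisoP G H :
  reflect (exists f : gmap G H, exists g : gmap H G,
             [/\ f \in Hom G H, g \in Hom H G,
                 cancel f.1 g.1 /\ cancel f.2 g.2
               & cancel g.1 f.1 /\ cancel g.2 f.2])
          (giso G H).
Proof.
apply: (iffP exists_inP) => [[f fH /exists_inP[g gH]] | [f [g [fH gH [a b] [c d]]]]].
  case/and4P=> /forallP a /forallP b /forallP c /forallP d.
  by exists f, g; split=> //; split=> x; apply/eqP.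
exists f => //; apply/exists_inP; exists g => //.
by apply/and4P; split; apply/forallP => x; apply/eqP.
Qed.

Definition gmap_id G : gmap G G := ([ffun x => x], [ffun e => e]).
Definition gmap_comp G H K (g : gmap H K) (f : gmap G H) : gmap G K :=
  ([ffun x => g.1 (f.1 x)], [ffun e => g.2 (f.2 e)]).

Lemma gmap_id_Hom G : gmap_id G \in Hom G G.
Proof. by rewrite inE; apply/forallP => e; rewrite /= !ffunE !eqxx. Qed.

Lemma gmap_comp_Hom G H K (g : gmap H K) (f : gmap G H) :
  g \in Hom H K -> f \in Hom G H -> gmap_comp g f \in Hom G K.
Proof.
rewrite !inE => /forallP Hg /forallP Hf; apply/forallP => e.
have /and3P[/eqP f1 /eqP f2 /eqP f3] := Hf e.
have /and3P[/eqP g1 /eqP g2 /eqP g3] := Hg (f.2 e).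
by rewrite /= !ffunE f1 g1 f2 g2 g3 f3 !eqxx.
Qed.

Lemma giso_refl : reflexive giso.
Proof.
move=> G; apply/gisoP; exists (gmap_id G), (gmap_id G).
by split; rewrite ?gmap_id_Hom //; split=> x; rewrite /= !ffunE.
Qed.

Lemma giso_sym : symmetric giso.
Proof.
by move=> G H; apply/gisoP/gisoP => -[f [g [fH gH [a b] [c d]]]]; exists g, f.
Qed.

Lemma giso_trans : transitive giso.
Proof.
move=> H G K /gisoP[f [g [fH gH [a b] [c d]]]] /gisoP[f' [g' [fH' gH' [a' b'] [c' d']]]].
apply/gisoP; exists (gmap_comp f' f), (gmap_comp g g').
split; rewrite ?gmap_comp_Hom //.
  by split=> x; rewrite /= !ffunE ?a' ?b' ?a ?b.
by split=> x; rewrite /= !ffunE ?c ?d ?c' ?d'.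
Qed.

(* A labeled graph homeomorphic to a segment (with at least one edge) is the
   subdivided segment below for the word u read along it: the edge (i, true)
   goes from vertex i to vertex i + 1 and carries the i-th letter of u, and
   (i, false) is its reverse. *)
Section Segment.
Variable u : seq (letter X).

Definition seg_vertex : finType := 'I_(size u).+1.
Definition arc : finType := ('I_(size u) * bool)%type.

Definition seg_origin (e : arc) : seg_vertex :=
  if e.2 then widen_ord (leqnSn _) e.1 else fintype.lift ord0 e.1.
Definition arc_rev (e : arc) : arc := (e.1, ~~ e.2).
Definition arc_label (e : arc) : letter X :=
  let a := tnth (in_tuple u) e.1 in if e.2 then a else linv a.

Lemma arc_revK : involutive arc_rev.
Proof. by case=> i b; rewrite /arc_rev /= negbK. Qed.

Lemma arc_rev_neq e : arc_rev e != e.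
Proof. by case: e => i b; rewrite /arc_rev xpair_eqE eqxx; case: b. Qed.

Lemma arc_label_rev e : arc_label (arc_rev e) = linv (arc_label e).
Proof. by case: e => i [] //=; rewrite /arc_label /= linvK. Qed.

Definition segment : lgraph X :=
  LGraph seg_origin arc_revK arc_rev_neq arc_label_rev.

(* Likewise for circles, with u nonempty: same edges, vertex indices taken
   modulo size u. *)
Definition circ_origin (e : arc) : 'I_(size u) :=
  if e.2 then e.1 else ordS e.1.

Definition circle : lgraph X :=
  LGraph circ_origin arc_revK arc_rev_neq arc_label_rev.

End Segment.

(* u-words: nontrivial folded labeled segments, up to isomorphism. *)
Record folded_segment := FoldedSegment {
  seg_word :> seq (letter X);
  _ : (seg_word != [::]) && folded (segment seg_word) }.
HB.instance Definition _ := [isSub for seg_word].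
HB.instance Definition _ := [Choice of folded_segment by <:].

Definition seg_iso : rel folded_segment :=
  fun u v => giso (segment u) (segment v).

Lemma seg_iso_refl : reflexive seg_iso. Proof. by move=> u; apply: giso_refl. Qed.
Lemma seg_iso_sym : symmetric seg_iso. Proof. by move=> u v; apply: giso_sym. Qed.
Lemma seg_iso_trans : transitive seg_iso.
Proof. by move=> v u w; apply: giso_trans. Qed.

Canonical seg_iso_equiv := EquivRel seg_iso seg_iso_refl seg_iso_sym seg_iso_trans.

Definition uword := {eq_quot seg_iso}.
HB.instance Definition _ := Choice.on uword.
HB.instance Definition _ := EqQuotient.on uword.

Definition uword_graph (u : uword) : lgraph X := segment (repr u).

(* The length l(u): number of unoriented edges. *)
Definition ulen (u : uword) : nat := size (repr u).

(* Cyclic words: folded labeled circles, up to isomorphism. *)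
Record folded_circle := FoldedCircle {
  circ_word :> seq (letter X);
  _ : (circ_word != [::]) && folded (circle circ_word) }.
HB.instance Definition _ := [isSub for circ_word].
HB.instance Definition _ := [Choice of folded_circle by <:].

Definition circ_iso : rel folded_circle :=
  fun u v => giso (circle u) (circle v).

Lemma circ_iso_refl : reflexive circ_iso. Proof. by move=> u; apply: giso_refl. Qed.
Lemma circ_iso_sym : symmetric circ_iso. Proof. by move=> u v; apply: giso_sym. Qed.
Lemma circ_iso_trans : transitive circ_iso.
Proof. by move=> v u w; apply: giso_trans. Qed.

Canonical circ_iso_equiv :=
  EquivRel circ_iso circ_iso_refl circ_iso_sym circ_iso_trans.

Definition cword := {eq_quot circ_iso}.
HB.instance Definition _ := Choice.on cword.
HB.instance Definition _ := EqQuotient.on cword.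

Definition cword_graph (w : cword) : lgraph X := circle (repr w).

Definition hom_count (u : uword) (w : cword) : nat :=
  #|Hom (uword_graph u) (cword_graph w)|.

End Graphs.

Section CyclicWords.
Variable X : finType.
Implicit Types u w : seq (letter X).

(* Deletes the first and the last letter when they are mutually inverse. *)
Definition cyc_step w : seq (letter X) :=
  if w is a :: s then if last a s == linv a then take (size s).-1 s else w
  else w.

Definition cyc_reduce w : seq (letter X) := iter (size w) cyc_step w.

Lemma cyc_stepP w : w != [::] -> word_reduced w ->
  [/\ cyc_step w != [::], word_reduced (cyc_step w)
    & (cyc_step w == w) || (size (cyc_step w) < size w)].
Proof.
case: w => [//|a s] _ Hs; rewrite /cyc_step; case: ifPn => [|_]; last first.
  by rewrite Hs eqxx.
case/lastP: s Hs => [|s b] Hs; first by rewrite /= eq_sym linv_neq.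
rewrite last_rcons => /eqP ba; subst b.
rewrite size_rcons /= -cats1 take_size_cat // cats1.
case: s Hs => [|b s] Hs; first by move: Hs; rewrite /word_reduced /= eqxx.
split=> //; last by rewrite /= !ltnS size_rcons leqnSn orbT.
by move: Hs; rewrite -rcons_cons /word_reduced /= rcons_path => /and3P[].
Qed.

Lemma cyc_iterP n w : size w <= n -> w != [::] -> word_reduced w ->
  [/\ iter n cyc_step w != [::], word_reduced (iter n cyc_step w)
    & cyc_step (iter n cyc_step w) = iter n cyc_step w].
Proof.
elim: n w => [|n IHn] w le_wn w0 wr; first by case: w le_wn w0 {wr}.
have [w0' wr' /orP[/eqP ww | lt_w]] := cyc_stepP w0 wr.
  have -> : iter n.+1 cyc_step w = w.
    by elim: n.+1 => //= m ->.
  by [].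
by rewrite iterSr; apply: IHn => //; rewrite -ltnS (leq_trans lt_w).
Qed.

(* Folded circles are the circles of nonempty cyclically reduced words. *)
Lemma folded_circle_nth (a0 : letter X) w :
  folded (circle w) =
  [forall i : 'I_(size w), nth a0 w (i.+1 %% size w) != linv (nth a0 w i)].
Proof.
apply/forallP/forallP => [wF i | wR e].
  apply/negP => /eqP wi.
  have /forallP/(_ (i, false)) := wF (ordS i, true).
  rewrite /= /arc_label /= /circ_origin /= eqxx /= !(tnth_nth a0) /= wi eqxx /=.
  by rewrite xpair_eqE andbF.
have lab (i j : 'I_(size w)) :
    i = ordS j -> tnth (in_tuple w) i != linv (tnth (in_tuple w) j).
  by move=> ->; rewrite !(tnth_nth a0) /=; apply: wR.
apply/forallP => -[j c]; case: e => i b /=; apply/implyP.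
rewrite /circ_origin /arc_label /= => /andP[].
case: b c => [] [] /=.
- by move=> /eqP ->.
- by move=> /eqP /lab /negPf ->.
- by rewrite eq_sym => /eqP /lab /negPf H; rewrite eq_sym H.
- by move=> /eqP /ordS_inj ->.
Qed.

Lemma folded_circle_reduced w : folded (circle w) -> word_reduced w.
Proof.
case: w => [//|a s]; rewrite (folded_circle_nth a) => /forallP wR.
apply/(sortedP a) => i lt_i.
have := wR (Ordinal (ltnW lt_i)).
by rewrite /= modn_small.
Qed.

Lemma folded_circle_step w :
  w != [::] -> word_reduced w -> cyc_step w = w -> folded (circle w).
Proof.
case: w => [//|a s] _ wr; rewrite /cyc_step.
case: ifPn => [_ /(congr1 size) | ls _].
  rewrite size_take_min /= => e.
  by have := geq_minr (size s).-1 (size s); rewrite e ltnn.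
rewrite (folded_circle_nth a); apply/forallP => i.
have := ltn_ord i; rewrite [X in _ < X -> _]/= ltnS leq_eqVlt.
case/orP => [/eqP -> | lt_i].
  rewrite /= modnn /= -[X in nth a X _]/(a :: s) nth_last /=.
  by apply: contra ls => /eqP {2}->; rewrite linvK.
rewrite modn_small ?ltnS //.
by have /(sortedP a)/(_ i lt_i) := wr.
Qed.

Lemma folded_circle_word (c : folded_circle X) :
  (c : seq (letter X)) != [::] /\ word_reduced c.
Proof.
by case/andP: (valP c) => c0 cF; split=> //; apply: folded_circle_reduced.
Qed.

Definition circle_elt (c : folded_circle X) : free_group X :=
  FreeGroup (proj2 (folded_circle_word c)).

Lemma circle_elt_neq1 c : circle_elt c != 1%g.
Proof. exact: (proj1 (folded_circle_word c)). Qed.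

Lemma cyc_reduce_folded (g : free_group X) : g != 1%g ->
  (cyc_reduce g != [::]) && folded (circle (cyc_reduce g)).
Proof.
move=> g0.
have [gc0 gr gs] := cyc_iterP (leqnn (size g)) g0 (valP g).
by rewrite gc0 folded_circle_step.
Qed.

(* The cyclic word of a nontrivial element of the free group. *)
Definition cyclic_word (g : free_group X) (g_neq1 : g != 1%g) : cword X :=
  \pi_(cword X) (FoldedCircle (cyc_reduce_folded g_neq1)).

Lemma group_aut_neq1 (phi : group_aut (free_group X)) g :
  g != 1%g -> phi g != 1%g.
Proof.
have phi1 : phi 1%g = 1%g.
  by apply: (mulgI (phi 1%g)); rewrite -group_autM !mulg1.
by rewrite -{2}phi1 (inj_eq (@group_aut_inj _ phi)).
Qed.

Definition cword_aut (phi : group_aut (free_group X)) (w : cword X) : cword X :=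
  cyclic_word (group_aut_neq1 phi (circle_elt_neq1 (repr w))).

End CyclicWords.

Local Open Scope ring_scope.

(* The homomorphism h with h (f z) = g z for all z when there is one (it is
   unique if f is surjective), and the zero map otherwise. *)
Definition induced (Z : Type) (A B : zmodType) (f : Z -> A) (g : Z -> B) :
    {additive A -> B} :=
  match pselect (exists h : {additive A -> B}, forall z, h (f z) = g z) with
  | left h_ex => projT1 (cid h_ex)
  | right _ => GRing.null_fun B
  end.

Lemma inducedP (Z : Type) (A B : zmodType) (f : Z -> A) (g : Z -> B) :
  (exists h : {additive A -> B}, forall z, h (f z) = g z) ->
  forall z, induced f g (f z) = g z.
Proof. by rewrite /induced; case: pselect => // h_ex _; case: cid. Qed.

Section Limit.
Variable X : finType.

(* The set W_k of u-words of length k (empty for k = 0). *)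
Record W (k : nat) := UWordOfLen { W_uword :> uword X; _ : ulen W_uword == k }.

Section WFinite.
Variable k : nat.
HB.instance Definition _ := [isSub for @W_uword k].
HB.instance Definition _ := [Choice of W k by <:].

Definition W_tuple (u : W k) : k.-tuple (letter X) :=
  Tuple (valP u : size (repr (W_uword u)) == k).

Definition W_of_tuple (t : k.-tuple (letter X)) : option (W k) :=
  obind (fun s => insub (\pi_(uword X) s)) (insub (val t)).

Lemma W_tupleK : pcancel W_tuple W_of_tuple.
Proof.
by move=> u; rewrite /W_of_tuple /= valK /= reprK valK.
Qed.

HB.instance Definition _ : isCountable (W k) := PCanIsCountable W_tupleK.
HB.instance Definition _ : isFinite (W k) := PCanIsFinite W_tupleK.
End WFinite.

Definition M (k : nat) := {freeg (W k) / int}.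
Definition ZC := {freeg (cword X) / int}.

HB.instance Definition _ k := GRing.Lmodule.on (M k).
HB.instance Definition _ := GRing.Lmodule.on ZC.

Definition pi_map (k : nat) : ZC -> M k :=
  fglift (fun w : cword X => \sum_(u : W k) << (hom_count u w)%:Z *g u >>).

Definition in_im_pi k : pred (M k) := fun v => `[< exists z, pi_map k z = v >].

Record tM (k : nat) := TM { tM_val :> M k; _ : in_im_pi tM_val }.
HB.instance Definition _ k := [isSub for @tM_val k].
HB.instance Definition _ k := [Choice of tM k by <:].

Lemma in_im_pi_closed k : zmod_closed (@in_im_pi k).
Proof.
have piB := lift_is_additive (fun w : cword X =>
  \sum_(u : W k) << (hom_count u w)%:Z *g u >> : M k).
split=> [|_ _ /asboolP[y <-] /asboolP[z <-]]; apply/asboolP; last first.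
  by exists (y - z); apply: piB.
by exists (0 - 0); rewrite [LHS]piB subrr.
Qed.

HB.instance Definition _ k :=
  GRing.SubChoice_isSubZmodule.Build (M k) (@in_im_pi k) (tM k)
    (@in_im_pi_closed k).

Lemma pi_in_im k z : in_im_pi (pi_map k z).
Proof. by apply/asboolP; exists z. Qed.

Definition tpi k (z : ZC) : tM k := TM (pi_in_im k z).

(* Characterized by p_map k (tpi k z) = tpi k.-1 z. *)
Definition p_map (k : nat) : {additive tM k -> tM k.-1} :=
  induced (tpi k) (tpi k.-1).

(* Indices start at 0; there are no u-words of length 0, so tM 0 = 0 and the
   extra component carries no information. *)
Definition tM_seq := forall k, tM k.
HB.instance Definition _ := Choice.on tM_seq.

Definition seq_zero : tM_seq := fun=> 0.
Definition seq_opp (v : tM_seq) : tM_seq := fun k => - v k.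
Definition seq_add (v w : tM_seq) : tM_seq := fun k => v k + w k.

Lemma seq_addA : associative seq_add.
Proof. by move=> u v w; apply: functional_extensionality_dep => k; apply: addrA. Qed.
Lemma seq_addC : commutative seq_add.
Proof. by move=> u v; apply: functional_extensionality_dep => k; apply: addrC. Qed.
Lemma seq_add0 : left_id seq_zero seq_add.
Proof. by move=> u; apply: functional_extensionality_dep => k; apply: add0r. Qed.
Lemma seq_addN : left_inverse seq_zero seq_opp seq_add.
Proof. by move=> u; apply: functional_extensionality_dep => k; apply: addNr. Qed.

HB.instance Definition _ :=
  GRing.isZmodule.Build tM_seq seq_addA seq_addC seq_add0 seq_addN.

Definition compatible : pred tM_seq :=
  fun v => `[< forall k, p_map k.+1 (v k.+1) = v k >].

Record limM := LimM { lim_val : tM_seq; _ : compatible lim_val }.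
HB.instance Definition _ := [isSub for lim_val].
HB.instance Definition _ := [Choice of limM by <:].

Lemma compatible_closed : zmod_closed compatible.
Proof.
split=> [|v w /asboolP v_p /asboolP w_p]; apply/asboolP => k.
  exact: raddf0.
by rewrite -[(v - w) k]/(v k - w k) -v_p -w_p -raddfB.
Qed.

HB.instance Definition _ :=
  GRing.SubChoice_isSubZmodule.Build tM_seq compatible limM compatible_closed.

Definition lim_comp (v : limM) (k : nat) : tM k := lim_val v k.

Definition ZC_aut (phi : group_aut (free_group X)) : ZC -> ZC :=
  fglift (fun w : cword X => << cword_aut phi w >> : ZC).

(* Finite multisets of u-words are given by their enumerations. *)
Definition counts_preimages (phi : group_aut (free_group X)) (u : uword X)
    (s : seq (uword X)) : Prop :=
  forall w : cword X,
    hom_count u (cword_aut phi w) = (\sum_(v <- s) hom_count v w)%N.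

Definition max_len (S : uword X -> seq (uword X)) (k : nat) : nat :=
  (\max_(u : W k) \max_(v <- S u) ulen v)%N.

(* Characterized by phi_map phi m k (tpi m z) = tpi k (ZC_aut phi z). *)
Definition phi_map (phi : group_aut (free_group X)) (m k : nat) :
    {additive tM m -> tM k} :=
  induced (tpi m) (fun z => tpi k (ZC_aut phi z)).

End Limit.

(* Main.v *)
From HB Require Import structures.
From mathcomp Require Import all_boot all_algebra.
From mathcomp Require Import generic_quotient boolp freeg zify.
Require Import Defs.

Set Implicit Arguments.
Unset Strict Implicit.
Unset Printing Implicit Defensive.

(** Cyclic words are handled through the cyclically reduced words spelling them.
   The number of morphisms from the segment of [u] to the circle of [c] is the
   number [hc u c] of occurrences of [u] and of its inverse along the periodic
   line [..ccc..] ([card_Hom]), and two circles are isomorphic exactly when their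
   words are conjugate up to inversion, which is also when they have the same
   counts [hc u] for all [u] ([cj_hc], [hc_eq_iso]).

   Existence of the multisets.  Occurrences of [u] in the image of a word are
   produced locally, because an automorphism of a free group has bounded
   cancellation ([bounded_cancellation], [img_local]): when a long word [q] is
   followed by [h], the effect of a letter put in front of [q] does not depend on
   [h].  The number of occurrences of [u] in the image of [x q h] minus that in
   the image of [q h] is thus a function of [x q], but it may be negative.
   Replacing the number of occurrences in the image of [g] by its minimum over
   the images of all reduced words ending with [g] keeps the locality and makes
   the increments nonnegative; summing them over one period of a long power of
   [w] expresses the count of [u] in the image of [w] as a combination of counts
   of words of a fixed length in [w], with coefficients in [nat] ([cocc_img]).

   The representation.  Counts of long words determine counts of shorter ones,
   so the kernels of the maps [tpi k] decrease with [k], and an automorphism maps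
   the kernel of [tpi m] into that of [tpi k] for [m] large.  An element of the
   inverse limit agrees at each level with some [z] in [ZC X], and the action at
   level [k] is computed by applying the automorphism to a [z] agreeing at a
   level high enough ([actE]); multiplicativity and triviality of inner
   automorphisms are inherited from the action on cyclic words.

   Faithfulness.  As counts separate cyclic words ([cword_sep]), automorphisms
   with the same action on the limit differ by one that fixes every cyclic word,
   that is, maps each element to a conjugate of it or of its inverse.  In rank at
   least 2 such an automorphism is inner ([pointwise_inner]), which is seen on
   the images of the generators, of the products of two generators and of one
   word distinguishing inversion of all generators from the identity. *)

(** * Words as elements of the free group *)

Section Words.
Variable X : finType.
Local Notation L := (letter X).
Implicit Types (a b : L) (u v w s t c : seq L) (g h k : free_group X).

Lemma reduced_catl u v : word_reduced (u ++ v) -> word_reduced u.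
Proof. by rewrite /word_reduced => /cat_sorted2[]. Qed.

Lemma reduced_catr u v : word_reduced (u ++ v) -> word_reduced v.
Proof. by rewrite /word_reduced => /cat_sorted2[]. Qed.

Lemma reduced_glue u v w : v != [::] ->
  word_reduced (u ++ v ++ w) = word_reduced (u ++ v) && word_reduced (v ++ w).
Proof.
case: v => [//|a v] _; rewrite /word_reduced.
case: u => [|b u] /=; rewrite !cat_path /= ?cat_path.
  by case: (path _ a v) => //=.
by case: (path _ a v); case: (path _ b u); case: (_ != _) => //=; rewrite ?andbT ?andbF.
Qed.

Lemma winv_cat u v : winv (u ++ v) = winv v ++ winv u.
Proof. by rewrite /winv map_cat rev_cat. Qed.

Lemma size_winv u : size (winv u) = size u.
Proof. by rewrite /winv size_rev size_map. Qed.

Lemma winv_cons a u : winv (a :: u) = rcons (winv u) (linv a).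
Proof. by rewrite /winv /= rev_cons. Qed.

Lemma winv_rcons a u : winv (rcons u a) = linv a :: winv u.
Proof. by rewrite /winv map_rcons rev_rcons. Qed.

Lemma winv_eq0 u : (winv u == [::]) = (u == [::]).
Proof. by rewrite -!size_eq0 size_winv. Qed.

Lemma reduced_winvE u : word_reduced (winv u) = word_reduced u.
Proof.
apply/idP/idP => [|]; last exact: reduced_winv.
by move/reduced_winv; rewrite winvK.
Qed.

(** The group element spelled by [u], which need not be reduced. *)
Definition fg u : free_group X :=
  FreeGroup (reduce_cat_reduced u (isT : word_reduced [::])).

Lemma fgK u : word_reduced u -> val (fg u) = u.
Proof. exact: reduce_cat0. Qed.

Lemma val_fgK g : fg (val g) = g.
Proof. by apply: val_inj; rewrite /= reduce_cat0 // (valP g). Qed.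

Lemma fg_cat u v : fg (u ++ v) = (fg u * fg v)%g.
Proof.
apply: val_inj; rewrite /= {1}/reduce_cat foldr_cat -/(reduce_cat _ _).
have vr := reduce_cat_reduced v (isT : word_reduced [::]).
exact: (reduce_catA u [::] vr).
Qed.

Lemma fg0 : fg [::] = 1%g. Proof. exact: val_inj. Qed.

Lemma fg_winv u : fg (winv u) = (fg u)^-1%g.
Proof.
have fgV a : fg [:: linv a] = (fg [:: a])^-1%g by apply: val_inj.
elim: u => [|a u IHu]; first exact: val_inj.
rewrite winv_cons -cats1 fg_cat IHu fgV -[a :: u]cat1s.
by rewrite fg_cat invgM.
Qed.

Lemma fg1V a : fg [:: linv a] = (fg [:: a])^-1%g.
Proof. exact: val_inj. Qed.

Lemma val_inv g : val (g^-1)%g = winv (val g). Proof. by []. Qed.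

(** As long as the last letter of [u] is inverse to the first of [v], both are
   removed; when this stops, what is left is reduced as it stands. *)
Lemma cancellation u v : word_reduced u -> word_reduced v ->
  exists p t q, [/\ u = p ++ winv t, v = t ++ q & word_reduced (p ++ q)].
Proof.
elim/last_ind: u v => [|u a IHu] v ur vr; first by exists [::], [::], v.
have ur' : word_reduced u by move: ur; rewrite -cats1 => /reduced_catl.
case: v vr => [|b v] vr.
  by exists (rcons u a), [::], [::]; rewrite !cats0.
have vr' := reduced_behead vr.
have [ba | ba] := eqVneq b (linv a); last first.
  exists (rcons u a), [::], (b :: v); rewrite cats0; split=> //.
  rewrite -cats1 -catA reduced_glue //= cats1 ur.
  by move: vr; rewrite /word_reduced /= => ->; rewrite ba.
have [p [t [q [up vt pq]]]] := IHu v ur' vr'.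
exists p, (b :: t), q; split=> //=; last by rewrite vt.
by rewrite winv_cons ba linvK -rcons_cat -up.
Qed.

Lemma size_mul g h : size (val (g * h)%g) <= size (val g) + size (val h).
Proof.
have [p [t [q [gp ht pq]]]] := cancellation (valP g) (valP h).
have -> : (g * h)%g = fg (p ++ q).
  by rewrite -(val_fgK g) -(val_fgK h) gp ht !fg_cat fg_winv mulgA mulgVK.
rewrite fgK // gp ht !size_cat; lia.
Qed.

(** * Occurrences in words and in periodic lines *)

Definition cpow c m : seq L := flatten (nseq m c).

Lemma cpowS c m : cpow c m.+1 = c ++ cpow c m. Proof. by []. Qed.

Lemma cpowD c m n : cpow c (m + n) = cpow c m ++ cpow c n.
Proof. by rewrite /cpow nseqD flatten_cat. Qed.

Lemma cpowSr c m : cpow c m.+1 = cpow c m ++ c.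
Proof. by rewrite -addn1 cpowD cpowS cats0. Qed.

Lemma size_cpow c m : size (cpow c m) = m * size c.
Proof. by elim: m => // m IHm; rewrite cpowS size_cat IHm mulSn. Qed.

Lemma fg_cpow c m : fg (cpow c m) = (fg c ^+ m)%g.
Proof.
by elim: m => [|m IHm]; rewrite ?expg0 ?fg0 // cpowS fg_cat IHm -expgS.
Qed.

(** Only the positions of the letters of [s] are starting points, so an empty [u]
   occurs [size s] times; this is what makes [occ_overlap] hold for it. *)
Fixpoint occ u s : nat :=
  if s is _ :: s' then prefix u s + occ u s' else 0.

Lemma occ_cons u a s : occ u (a :: s) = prefix u (a :: s) + occ u s.
Proof. by []. Qed.

Lemma prefix_cat_long u s t : size u <= size s -> prefix u (s ++ t) = prefix u s.
Proof. by move=> us; rewrite !prefixE takel_cat. Qed.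

(** An occurrence is not longer than [s], so it lies in [p ++ s] or in [s ++ q];
   the occurrences lying in both are those inside [s]. *)
Lemma occ_overlap u p s q : size u <= size s ->
  occ u (p ++ s ++ q) + occ u s = occ u (p ++ s) + occ u (s ++ q).
Proof.
move=> us; elim: p => [|a p IHp]; first by rewrite !cat0s addnC.
rewrite !cat_cons !occ_cons.
have -> : prefix u (a :: p ++ s ++ q) = prefix u (a :: p ++ s).
  by rewrite -!cat_cons catA prefix_cat_long //= size_cat; lia.
lia.
Qed.

Lemma occ_cat u s t :
  occ u (s ++ t) = \sum_(i < size s) prefix u (drop i (s ++ t)) + occ u t.
Proof.
elim: s => [|a s IHs]; first by rewrite big_ord0.
by rewrite big_ord_recl cat_cons occ_cons IHs addnA.
Qed.

(** Occurrences of [u] in the bi-infinite periodic word [..ccc..], up to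
   translation by the period. *)
Definition cocc u c : nat :=
  \sum_(i < size c) prefix u (drop i (cpow c (size u).+1)).

(** An occurrence starting in the first period ends within the next [size u]
   letters, so neither the exponent nor what follows the power matters. *)
Lemma coccE u c m s : size u <= size (cpow c m) ->
  cocc u c = \sum_(i < size c) prefix u (drop i (c ++ cpow c m ++ s)).
Proof.
move=> um; rewrite /cocc; apply: eq_bigr => i _; congr (nat_of_bool _).
have le_i := ltnW (ltn_ord i).
have E n t : size u <= size (cpow c n) ->
  prefix u (drop i (c ++ cpow c n ++ t)) =
  prefix u (drop i (c ++ cpow c n)).
  move=> un; rewrite catA drop_cat size_cat.
  case: ltnP => [_|]; last by have := ltn_ord i; lia.
  by rewrite prefix_cat_long // size_drop size_cat; lia.
have um' : size u <= size (cpow c (size u)).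
  by rewrite size_cpow leq_pmulr //; have := ltn_ord i; lia.
rewrite E // cpowS -(E _ (cpow c m)) // -cpowD addnC cpowD E //.
Qed.

Lemma occ_period u c m s : size u <= size (cpow c m) ->
  occ u (c ++ cpow c m ++ s) = cocc u c + occ u (cpow c m ++ s).
Proof. by move=> um; rewrite occ_cat -coccE. Qed.

(** The occurrences gained with one more period are those starting in it. *)
Lemma occ_period2 u p c m q : size u <= size (cpow c m) ->
  occ u (p ++ cpow c m.+1 ++ q) = cocc u c + occ u (p ++ cpow c m ++ q).
Proof.
move=> um; have := occ_overlap p (c ++ q) um.
have := occ_overlap p q um; have := occ_period q um.
by rewrite cpowSr -!catA !(catA _ c) -cpowSr cpowS -!catA; lia.
Qed.

(** A rotation shifts the starting positions by one; the one lost at the beginning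
   is found again one period later. *)
Lemma cocc_rot1 u c : cocc u (rot 1 c) = cocc u c.
Proof.
case: c => [//|a c].
have us m : size u <= size (cpow (a :: c) (size u + m)).
  by rewrite size_cpow /= mulnS; lia.
have E m : a :: cpow (rot 1 (a :: c)) m = cpow (a :: c) m ++ [:: a].
  rewrite rot1_cons -cats1; elim: m => // m IHm.
  by rewrite [in RHS]cpowS -catA -IHm cpowS -catA.
pose r i := prefix u (drop i (cpow (a :: c) (size u).+2)) : nat.
have -> : cocc u (a :: c) = \sum_(i < size (a :: c)) r i.
  by rewrite (@coccE u (a :: c) (size u + 1) [::]) // cats0 -cpowS addn1.
have -> : cocc u (rot 1 (a :: c)) = \sum_(i < size (a :: c)) r i.+1.
  have us' : size u <= size (cpow (rot 1 (a :: c)) (size u + 1)).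
    by rewrite size_cpow size_rot /= mulnS; lia.
  rewrite (coccE [::] us') cats0 -cpowS size_rot; apply: eq_bigr => i _.
  have <- : prefix u (drop i.+1 (cpow (a :: c) (size u).+2 ++ [:: a])) = r i.+1 :> nat.
    rewrite /r drop_cat ifT; last first.
      by rewrite size_cpow; have := ltn_ord i; rewrite !mulSn; lia.
    rewrite prefix_cat_long // size_drop size_cpow; have := ltn_ord i.
    by rewrite /= !mulSn mulnS; lia.
  by rewrite -E addn1.
rewrite big_ord_recr [RHS]big_ord_recl /= addnC; congr (_ + _).
rewrite -[X in X = _]/(r (size (a :: c))) /r drop0.
rewrite {1}(cpowS _ (size u).+1) drop_size_cat //.
by rewrite [in RHS]cpowSr prefix_cat_long // -addn1 us.
Qed.

(** The periodic line never ends: each occurrence is followed by a letter. *)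
Lemma cocc_rcons u c : cocc u c = \sum_(a : L) cocc (rcons u a) c.
Proof.
case: c => [|b c]; first by rewrite /cocc big_ord0 big1 // => a _; rewrite big_ord0.
have us : size u < size (cpow (b :: c) (size u).+1).
  by rewrite size_cpow /= mulnS; lia.
under eq_bigr => a _ do rewrite (@coccE _ _ (size u).+1 [::]) ?size_rcons //.
rewrite (@coccE _ _ (size u).+1 [::] (ltnW us)) exchange_big; apply: eq_bigr => i _.
rewrite cats0; set s := drop i _.
have: size u < size s by rewrite /s size_drop size_cat; have := ltn_ord i; lia.
move: s => s; elim: u s {us} => [|x u IHu] [|y s] //= us.
  rewrite (bigD1 y) //= eqxx prefix0s big1 ?addn0 // => a /negPf.
  by move=> ->.
have [_|ne] := boolP (x == y) => /=; first exact: IHu.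
by rewrite big1.
Qed.

Lemma sum_cocc1 c : \sum_(a : L) cocc [:: a] c = size c.
Proof.
transitivity (cocc [::] c); first by rewrite cocc_rcons.
by rewrite /cocc; under eq_bigr do rewrite prefix0s; rewrite sum1_card card_ord.
Qed.

Lemma cocc_eq_rot u c : size u = size c -> 0 < cocc u c -> exists i, u = rot i c.
Proof.
move=> uc; rewrite lt0n sum_nat_eq0 negb_forall => /existsP[i].
case: i => i lt_i /=; rewrite eqb0 negbK => ui; exists i; apply/eqP; move: ui.
rewrite cpowS drop_cat lt_i.
have -> : cpow c (size u) = c ++ cpow c (size c).-1.
  by rewrite uc -cpowS (ltn_predK lt_i).
have -> : drop i c ++ c ++ cpow c (size c).-1 = (drop i c ++ c) ++ cpow c (size c).-1.
  by rewrite catA.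
rewrite prefixE uc takel_cat ?size_cat ?leq_addl // take_cat size_drop.
rewrite ltnNge leq_subr /=.
by rewrite subKn ?(ltnW lt_i) // eq_sym.
Qed.

Lemma cocc_self c : c != [::] -> 0 < cocc c c.
Proof.
case: c => [//|a c] _; rewrite /cocc big_ord_recl drop0.
by rewrite cpowS prefix_prefix.
Qed.

End Words.

(** * Morphisms from segments to circles *)

Section Arcs.
Variable X : finType.
Local Notation L := (letter X).
Implicit Types (a b : L) (u v w s t c : seq L).

Lemma prefix_nth a u s i : i + size u <= size s ->
  prefix u (drop i s) = [forall j : 'I_(size u), nth a s (i + j) == nth a u j].
Proof.
move=> us; rewrite prefixE; apply/eqP/forallP => [E j | E].
  by rewrite -nth_drop -{2}E nth_take.
have sz : size (take (size u) (drop i s)) = size u.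
  by rewrite size_takel // size_drop; lia.
apply: (@eq_from_nth _ a) => // j; rewrite sz => lt_j.
by rewrite nth_take // nth_drop (eqP (E (Ordinal lt_j))).
Qed.

Lemma nth_cpow a c m k : k < m * size c -> nth a (cpow c m) k = nth a c (k %% size c).
Proof.
elim: m k => [//|m IHm] k; rewrite cpowS nth_cat mulSn => lt_k.
case: ltnP => [lt|le]; first by rewrite modn_small.
by rewrite IHm; [rewrite -{2}(subnK le) modnDr | lia].
Qed.

Lemma iter_ordS n (i : 'I_n) j : val (iter j (@ordS n) i) = (i + j) %% n.
Proof.
elim: j => [|j IHj]; first by rewrite addn0 modn_small.
by rewrite iterS /= IHj -[(_ %% _).+1]addn1 modnDml addn1 addnS.
Qed.

Lemma iter_ord_pred n (i : 'I_n) j :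
  iter j (@ord_pred n) i = rev_ord (iter j (@ordS n) (rev_ord i)).
Proof.
elim: j => [|j IHj]; first by rewrite rev_ordK.
rewrite !iterS IHj; apply: (can_inj (@ordSK n)); rewrite ord_predK.
case: (iter _ _ _) => k lt_k; apply: val_inj => /=.
move: lt_k; case: (ltngtP k.+1 n) => [lt||<-] _; last 2 first.
- by lia.
- by rewrite modnn subn1 /= modnn subnn.
by rewrite (modn_small lt) -subSn // modn_small; lia.
Qed.

Section Circle.
Variable c : seq L.

(** The next arc met when a circle is followed in the direction of an arc. *)
Definition arc_next (e : arc c) : arc c :=
  (if e.2 then ordS e.1 else ord_pred e.1, e.2).

Lemma origin_next e : circ_origin (arc_next e) = circ_origin (arc_rev e).
Proof. by case: e => i [] //=; rewrite /circ_origin /= ord_predK. Qed.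

Lemma iter_next i (b : bool) j :
  iter j arc_next (i, b) = (iter j (if b then @ordS _ else @ord_pred _) i, b).
Proof. by elim: j => // j IHj; rewrite !iterS IHj; case: b {IHj}. Qed.

(** A circle goes on in a single way, apart from turning back. *)
Lemma origin_rev_cases e e' : circ_origin e' = circ_origin (arc_rev e) ->
  e' = arc_next e \/ e' = arc_rev e.
Proof.
case: e e' => i [] [j []]; rewrite /circ_origin /arc_next /arc_rev /=.
- by move=> ->; left.
- by move/ordS_inj ->; right.
- by move=> ->; right.
- by move=> <-; left; rewrite ordSK.
Qed.

Definition reads u (e : arc c) : bool :=
  [forall j : 'I_(size u), arc_label (iter j arc_next e) == tnth (in_tuple u) j].

Lemma reads_fwd u (i : 'I_(size c)) :
  reads u (i, true) = prefix u (drop i (cpow c (size u).+1)).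
Proof.
have c0 : 0 < size c by apply: leq_ltn_trans (ltn_ord i).
case: u => [|a u]; first by rewrite prefix0s; apply/forallP; case.
rewrite (prefix_nth a); last first.
  rewrite size_cpow mulSn leq_add ?(ltnW (ltn_ord i)) // leq_pmulr //.
apply: eq_forallb => j; rewrite iter_next /arc_label /= !(tnth_nth a) /=.
rewrite iter_ordS nth_cpow // mulSn -addnS leq_add ?(ltnW (ltn_ord i)) //.
by rewrite (leq_trans (ltn_ord j)) // leq_pmulr.
Qed.

(** Following the circle of [c] backwards is reading the inverse of [c]. *)
Lemma reads_bwd u (i : 'I_(size c)) :
  reads u (i, false) = prefix u (drop (rev_ord i) (cpow (winv c) (size u).+1)).
Proof.
have c0 : 0 < size c by apply: leq_ltn_trans (ltn_ord i).
case: u => [|a u]; first by rewrite prefix0s; apply/forallP; case.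
have lt_r := ltn_ord (rev_ord i).
rewrite (prefix_nth a); last first.
  by rewrite size_cpow mulSn size_winv leq_add ?(ltnW lt_r) // leq_pmulr.
apply: eq_forallb => j; rewrite iter_next /arc_label /= !(tnth_nth a) /=.
rewrite nth_cpow size_winv; last first.
  rewrite mulSn -addnS leq_add ?(ltnW lt_r) //.
  by rewrite (leq_trans (ltn_ord j)) // leq_pmulr.
have lt_m := ltn_pmod ((size c - i.+1) + j) c0.
rewrite iter_ord_pred /winv nth_rev size_map // (nth_map a) ?rev_ord_subproof //.
  by rewrite /= iter_ordS.
by lia.
Qed.

Lemma card_reads u : #|[set e | reads u e]| = cocc u c + cocc u (winv c).
Proof.
rewrite -sum1dep_card big_mkcond.
transitivity (\sum_(i < size c) (reads u (i, true) + reads u (i, false))).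
  pose r (i : 'I_(size c)) (b : bool) : nat := reads u (i, b).
  transitivity (\sum_p r p.1 p.2).
    by apply: eq_bigr => e _; rewrite /r -surjective_pairing; case: reads.
  by rewrite -(pair_bigA _ r); apply: eq_bigr => i _; rewrite big_bool.
rewrite big_split /=; congr (_ + _).
  by apply: eq_bigr => i _; rewrite reads_fwd.
rewrite /cocc size_winv (reindex_inj (@rev_ord_inj _)) /=.
by apply: eq_bigr => i _; rewrite reads_bwd rev_ordK.
Qed.

Definition read_map u (e : arc c) : gmap (segment u) (circle c) :=
  ([ffun x : 'I_(size u).+1 => circ_origin (iter x arc_next e)],
   [ffun d : arc u => if d.2 then iter d.1 arc_next e
                      else arc_rev (iter d.1 arc_next e)]).

Lemma read_map_Hom u e : reads u e -> read_map u e \in Hom (segment u) (circle c).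
Proof.
move/forallP => ue; rewrite inE; apply/forallP => -[j b] /=; rewrite !ffunE /=.
case: b => /=; rewrite /seg_origin /= ?arc_revK ?eqxx /=.
  by rewrite (eqP (ue j)).
by rewrite add0n origin_next eqxx arc_label_rev (eqP (ue j)) /=.
Qed.

(** A morphism from a folded segment cannot turn back, hence it is determined by
   the image of the first edge. *)
Lemma Hom_read_map u (f : gmap (segment u) (circle c)) (i0 : 'I_(size u)) :
  val i0 = 0 -> folded (segment u) -> f \in Hom (segment u) (circle c) ->
  f = read_map u (f.2 (i0, true)) /\ reads u (f.2 (i0, true)).
Proof.
move=> i00 uF; rewrite inE => /forallP fH; set e : arc c := f.2 (i0, true).
have fO (d : arc u) : f.1 (seg_origin d) = circ_origin (f.2 d).
  by have /and3P[/eqP] := fH d.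
have fR (d : arc u) : f.2 (arc_rev d) = arc_rev (f.2 d).
  by have /and3P[_ /eqP] := fH d.
have fL (d : arc u) : arc_label (f.2 d) = arc_label d.
  by have /and3P[_ _ /eqP] := fH d.
have fE j : f.2 (j, true) = iter j arc_next e.
  case: j => j /=; elim: j => [|j IHj] lt_j.
    by congr (f.2 (_, _)); apply: val_inj.
  have lt_j' := ltnW lt_j; rewrite iterS -(IHj lt_j').
  set d := (Ordinal lt_j, true); set d' := (Ordinal lt_j', true).
  have dd : seg_origin d = seg_origin (arc_rev d') by apply: val_inj.
  have := fO d; rewrite dd fO fR => /esym/origin_rev_cases[//|].
  rewrite -fR => fdd.
  have /forallP/(_ d)/forallP/(_ (arc_rev d')) := uF.
  rewrite /= dd eqxx -(fL d) fdd fL eqxx /= /arc_rev.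
  by rewrite xpair_eqE andbF.
have fE' j : f.2 (j, false) = arc_rev (iter j arc_next e) by rewrite -fE -fR.
split; last by apply/forallP => j; rewrite -fE fL.
rewrite [f]surjective_pairing; congr pair; apply/ffunP => /=; last first.
  by case=> j []; rewrite ffunE.
move=> x; rewrite ffunE; have [x0|x0] := posnP x.
  by rewrite x0 -[iter _ _ _]/e -fO; congr (f.1 _); apply: val_inj => /=; rewrite x0.
have lt_x : x.-1 < size u by have := ltn_ord x; lia.
have -> : x = seg_origin (Ordinal lt_x, false) by apply: val_inj; rewrite /= /bump leq0n; lia.
by rewrite fO fE' -origin_next /= add0n.
Qed.

(** The two terms count the morphisms by the orientation of the first arc. *)
Lemma card_Hom u : u != [::] -> folded (segment u) ->
  #|Hom (segment u) (circle c)| = cocc u c + cocc u (winv c).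
Proof.
rewrite -size_eq0 -lt0n => u0 uF; pose i0 := Ordinal u0.
rewrite -card_reads -(card_in_imset (f := read_map u)); last first.
  move=> e e' _ _ ee'.
  have := congr1 (fun f : gmap (segment u) (circle c) => f.2 (i0, true)) ee'.
  by rewrite !ffunE.
apply: eq_card => f; apply/idP/imsetP => [fH | [e]].
  have [E R] := Hom_read_map (erefl : val i0 = 0) uF fH.
  by exists (f.2 (i0, true)); rewrite // inE.
by rewrite inE => /read_map_Hom He ->.
Qed.

End Circle.

Lemma giso_bij (G H : lgraph X) (f : gmap G H) :
  f \in Hom G H -> bijective f.1 -> bijective f.2 -> giso G H.
Proof.
move=> fH [g1 f1K g1K] [g2 f2K g2K]; apply/gisoP.
exists f, ([ffun x => g1 x], [ffun e => g2 e]); split=> //; last 2 first.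
- by split=> x; rewrite ffunE ?f1K ?f2K.
- by split=> x; rewrite ffunE ?g1K ?g2K.
move: fH; rewrite !inE => /forallP fH; apply/forallP => e; rewrite !ffunE.
have /and3P[/eqP O /eqP R /eqP E] := fH (g2 e).
rewrite g2K in O E R.
by rewrite -O f1K -R f2K E !eqxx.
Qed.

(** Reading the whole of [c] around [d] once is an isomorphism. *)
Lemma giso_reads c (d : seq L) (e : arc d) : size c = size d -> reads c e ->
  giso (circle c) (circle d).
Proof.
move=> cd /forallP ce.
pose F j := iter j (@arc_next d) e.
have F2 j : (F j).2 = e.2 by rewrite /F; case: (e) => i b; rewrite iter_next.
have F1 j : (F j).1 = iter j (if e.2 then @ordS _ else @ord_pred _) e.1.
  by rewrite /F; case: (e) => i b; rewrite iter_next.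
have FE j k : (F j == F k) = (j == k %[mod size d]).
  rewrite -pair_eqE /pair_eq !F2 eqxx andbT !F1; case: ifP => _.
    by rewrite -val_eqE /= !iter_ordS eqn_modDl.
  by rewrite !iter_ord_pred (inj_eq rev_ord_inj) -val_eqE /= !iter_ordS eqn_modDl.
pose f : gmap (circle c) (circle d) :=
  ([ffun i : 'I_(size c) => circ_origin (F i)],
   [ffun a : arc c => if a.2 then F a.1 else arc_rev (F a.1)]).
have Finj : injective (fun i : 'I_(size c) => F i).
  move=> i j /eqP; rewrite FE !modn_small -?cd //.
  by move/eqP/val_inj.
have FS (i : 'I_(size c)) : F (ordS i) = arc_next (F i).
  by apply/eqP; rewrite -[arc_next _]/(F i.+1) FE -cd /= modn_mod.
apply: (@giso_bij _ _ f).
- rewrite inE; apply/forallP => -[i b]; rewrite !ffunE /=.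
  case: b; rewrite /circ_origin /= ?arc_revK ?eqxx /=.
    by rewrite (eqP (ce i)).
  rewrite -!/(circ_origin _) FS origin_next eqxx.
  by rewrite arc_label_rev (eqP (ce i)) /=.
- apply: inj_card_bij; last by rewrite !card_ord cd.
  move=> i j; rewrite !ffunE => E; apply: Finj.
  apply/eqP; rewrite -pair_eqE /pair_eq !F2 eqxx andbT; apply/eqP.
  move: E; rewrite /circ_origin !F2; case: (e.2) => //; exact: ordS_inj.
- apply: inj_card_bij; last by rewrite !card_prod !card_ord cd.
  move=> [i b] [j b']; rewrite !ffunE /= => E.
  have bb : b = b'.
    move: (congr1 snd E); case: (b) (b') => [] [] //=; rewrite !F2; by case: e.2.
  rewrite -bb in E *; congr pair; apply: Finj.
  by case: (b) E => // /(can_inj (@arc_revK _ _)).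
Qed.

Lemma giso_card_Hom G (H K : lgraph X) : giso H K -> #|Hom G H| = #|Hom G K|.
Proof.
have le H' K' : giso H' K' -> #|Hom G H'| <= #|Hom G K'|.
  case/gisoP=> f [g [fH gH [f1K f2K] _]].
  rewrite -(card_in_imset (f := fun h => gmap_comp f h)).
    by apply/subset_leq_card/subsetP => _ /imsetP[h hH ->]; apply: gmap_comp_Hom.
  move=> h h' _ _ [] /ffunP E1 /ffunP E2.
  rewrite [h]surjective_pairing [h']surjective_pairing; congr pair.
    by apply/ffunP => x; have := E1 x; rewrite !ffunE => /(can_inj f1K).
  by apply/ffunP => x; have := E2 x; rewrite !ffunE => /(can_inj f2K).
by move=> HK; apply/eqP; rewrite eqn_leq !le // giso_sym.
Qed.

Lemma giso_segment_size u v : giso (segment u) (segment v) -> size u = size v.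
Proof.
case/gisoP=> f [g [_ _ [f1K _] [g1K _]]].
have := bij_eq_card (Bijective f1K g1K).
by rewrite !card_ord => -[].
Qed.

Lemma folded_segment_reduced u : folded (segment u) = word_reduced u.
Proof.
case: u => [|a s]; first by apply/forallP => -[[]].
set u := a :: s.
apply/forallP/(sortedP a) => [uF i lt_i | uR [i b]].
  apply/negP => /eqP ui.
  pose j := Ordinal lt_i; pose k := Ordinal (ltnW lt_i).
  have /forallP/(_ (k, false)) := uF (j, true).
  have -> : origin (l := segment u) (j, true) = origin (l := segment u) (k, false).
    exact: val_inj.
  have -> : label (l := segment u) (j, true) = label (l := segment u) (k, false).
    by rewrite /= /arc_label !(tnth_nth a); exact: ui.
  by rewrite !eqxx /= xpair_eqE andbF.
have lab (j k : 'I_(size u)) : val j = k.+1 ->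
    tnth (in_tuple u) j != linv (tnth (in_tuple u) k).
  move=> jk; rewrite !(tnth_nth a) /= jk; apply: uR; rewrite -jk; exact: ltn_ord.
apply/forallP => -[j b']; apply/implyP; rewrite /= /seg_origin /arc_label /=.
rewrite -val_eqE; case: b; case: b' => /=; rewrite ?/bump ?leq0n ?add1n => /andP[/eqP ij].
- by move=> _; rewrite xpair_eqE eqxx andbT -val_eqE; apply/eqP.
- by rewrite (negPf (lab _ _ ij)).
- by rewrite eq_sym (negPf (lab _ _ (esym ij))).
- by move=> _; rewrite xpair_eqE eqxx andbT -val_eqE /=; case: ij => ->.
Qed.

End Arcs.

(** * Cyclic words and conjugacy classes *)

Section CyclicClasses.
Variable X : finType.
Local Notation L := (letter X).
Local Open Scope quotient_scope.
Implicit Types (a b : L) (u v w s t c d : seq L) (g h k : free_group X).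
Implicit Types phi psi : group_aut (free_group X).

(** Cyclically reduced words are those whose circle is folded ([cycredE]); this form
   suits concatenation better than a condition on the first and last letters. *)
Definition cycred c : bool := (c != [::]) && word_reduced (c ++ c).

Lemma cycred_cycle c : cycred c = (c != [::]) && cycle (fun a b => b != linv a) c.
Proof.
rewrite /cycred; case: c => [//|a s]; congr (_ && _).
rewrite /word_reduced /= rcons_path cat_path /=.
by case: (path _ a s); rewrite ?andbT.
Qed.

Lemma cycredE c : cycred c = (c != [::]) && folded (circle c).
Proof.
rewrite cycred_cycle; case: c => [//|a s]; congr (_ && _).
rewrite (folded_circle_nth a); apply/(pathP a)/forallP => [R i | R i].
  have lt_i := ltn_ord i; have := R i; rewrite size_rcons => /(_ lt_i).
  rewrite -rcons_cons !nth_rcons lt_i; case: (ltngtP i (size s)) => [lt|lt|E] ?.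
  - by rewrite modn_small.
  - by have := lt_i; rewrite /= ltnS leqNgt lt.
  - by have -> : i.+1 = size (a :: s); rewrite ?modnn // E.
rewrite size_rcons => lt_i; have := R (Ordinal lt_i).
rewrite -rcons_cons !nth_rcons lt_i /=.
case: (ltngtP i (size s)) => [lt|lt|->].
- by rewrite modn_small.
- by have := lt_i; rewrite /= ltnS leqNgt lt.
- by rewrite modnn.
Qed.

Lemma circle_cycred (c : folded_circle X) : cycred c.
Proof. by rewrite cycredE (valP c). Qed.

Lemma cycred_reduced c : cycred c -> word_reduced c.
Proof. by case/andP=> _ /reduced_catl. Qed.

Lemma cycred_winv c : cycred (winv c) = cycred c.
Proof. by rewrite /cycred winv_eq0 -winv_cat reduced_winvE. Qed.

Lemma cycred_rot i c : cycred (rot i c) = cycred c.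
Proof. by rewrite !cycred_cycle rot_cycle -!size_eq0 size_rot. Qed.

Lemma reduced_cpow c m : cycred c -> word_reduced (cpow c m).
Proof.
case/andP=> c0 cc; elim: m => [//|[|m] IHm].
  by rewrite cpowS cats0; apply: reduced_catl cc.
by rewrite !cpowS reduced_glue // cc -cpowS.
Qed.

Lemma fg_rot i c : fg (rot i c) = (fg c ^ fg (take i c))%g.
Proof. by rewrite conjgE -[c in (fg c * _)%g](cat_take_drop i) !fg_cat -mulgA mulKg. Qed.

Lemma reduced_rcons_cons s b a t :
  word_reduced (rcons s b ++ a :: t) =
  [&& word_reduced (rcons s b), a != linv b & word_reduced (a :: t)].
Proof. by rewrite -cats1 -catA -[[:: b] ++ _]/([:: b] ++ a :: t) reduced_glue. Qed.

(** If a reduced word [k] conjugates one cyclically reduced word to another, the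
   letters of [k] cancel one at a time against an end of the first word, each
   time rotating it; otherwise [k c k^-1] is reduced as written and not
   cyclically reduced.  The conclusion records invariants of rotations, which
   are easier to chain than rotations and determine them ([cocc_eq_rot]). *)
Lemma conj_cocc (k : seq L) c d : cycred c -> cycred d -> word_reduced k ->
  fg d = fg (k ++ c ++ winv k) -> size d = size c /\ forall u, cocc u d = cocc u c.
Proof.
elim/last_ind: k c => [|k b IHk] c cR dR kR.
  move=> /(congr1 val); rewrite /= !cats0 !reduce_cat0; first by move->.
    exact: cycred_reduced cR.
  exact: cycred_reduced dR.
have kR' : word_reduced k by move: kR; rewrite -cats1 => /reduced_catl.
have step c' : fg (b :: c ++ [:: linv b]) = fg c' ->
    fg (rcons k b ++ c ++ winv (rcons k b)) = fg (k ++ c' ++ winv k).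
  move=> E; rewrite winv_rcons.
  have -> : rcons k b ++ c ++ linv b :: winv k = k ++ (b :: c ++ [:: linv b]) ++ winv k.
    by rewrite -cats1 -!catA /= -catA.
  by rewrite fg_cat (fg_cat (b :: _)) E -!fg_cat.
have c0 : c != [::] by case/andP: cR.
have fb : fg [:: b] = (fg [:: linv b])^-1%g by rewrite fg1V invgK.
have [[s cE] | hd] := pselect (exists s, c = linv b :: s).
  move=> dE; case: (IHk (rot 1 c)); rewrite ?cycred_rot //.
    rewrite dE; apply: step; rewrite cE rot1_cons -cats1.
    by rewrite -cat1s !fg_cat -[linv b :: s]cat1s fg_cat fb !mulgA mulVg mul1g.
  by rewrite size_rot => -> cc; split=> // u; rewrite cc cocc_rot1.
have [[s cE] | tl] := pselect (exists s, c = rcons s b).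
  have cE' : c = rot 1 (b :: s) by rewrite rot1_cons.
  have cR' : cycred (b :: s) by rewrite -(cycred_rot 1) -cE'.
  move=> dE; case: (IHk (b :: s)) => //.
    rewrite dE; apply: step; rewrite cE -cats1 -catA /=.
    rewrite -[b :: s ++ _]/((b :: s) ++ ([:: b] ++ [:: linv b])).
    by rewrite fg_cat (fg_cat [:: b]) fb mulVg mulg1.
  by rewrite cE' size_rot => -> cc; split=> // u; rewrite cc cocc_rot1.
have red : word_reduced (rcons k b ++ c ++ winv (rcons k b)).
  rewrite reduced_glue //; apply/andP; split.
    case: c c0 cR hd {tl step} => [//|a s] _ cR hd.
    rewrite reduced_rcons_cons kR (cycred_reduced cR) andbT /=.
    by apply/eqP => ab; case: hd; exists s; rewrite ab.
  case/lastP: c c0 cR tl {hd step} => [//|s a] _ cR tl.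
  rewrite winv_rcons reduced_rcons_cons (cycred_reduced cR) -winv_rcons.
  rewrite reduced_winvE kR andbT andTb; apply/eqP => /(can_inj (@linvK X)) ab.
  by case: tl; exists s; rewrite ab.
move=> /(congr1 val); rewrite !fgK ?(cycred_reduced dR) // => dE.
move: dR; rewrite dE => /andP[_]; case: {+}(rcons k b) (headI k b) => // a k' _.
rewrite -!catA => /reduced_catr/reduced_catr; rewrite catA => /reduced_catl.
by rewrite winv_cons reduced_rcons_cons linvK eqxx andbF.
Qed.

Lemma conjg_cocc g c d : cycred c -> cycred d -> fg d = (fg c ^ g)%g ->
  size d = size c /\ forall u, cocc u d = cocc u c.
Proof.
move=> cR dR dE; apply: (@conj_cocc (val g^-1%g) c d) => //; first exact: valP.
by rewrite dE !fg_cat fg_winv !val_fgK invgK conjgE.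
Qed.

(** Conjugacy up to inversion: nontrivial elements define the same cyclic word
   exactly when they are so related ([cyclic_word_cj]). *)
Definition cj g h : Prop := exists k, (h = g ^ k \/ h = g^-1 ^ k)%g.

Lemma cj_refl g : cj g g.
Proof. by exists 1%g; left; rewrite conjg1. Qed.

Lemma cj_sym g h : cj g h -> cj h g.
Proof.
case=> k [->|->]; exists k^-1%g; [left|right]; rewrite -?conjVg conjgK //.
by rewrite invgK.
Qed.

Lemma cj_trans h g k : cj g h -> cj h k -> cj g k.
Proof.
case=> x [->|->] [y [->|->]]; exists (x * y)%g; rewrite -?conjVg ?invgK -conjgM.
- by left.
- by right.
- by right.
- by left.
Qed.

Lemma cjV g : cj g g^-1%g.
Proof. by exists 1%g; right; rewrite conjg1. Qed.

Lemma cjJ g k : cj g (g ^ k)%g.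
Proof. by exists k; left. Qed.

Lemma group_aut1 phi : phi 1%g = 1%g.
Proof. by apply: (mulgI (phi 1%g)); rewrite -group_autM !mulg1. Qed.

Lemma group_autV phi g : phi g^-1%g = (phi g)^-1%g.
Proof. by apply: (mulgI (phi g)); rewrite -group_autM !mulgV group_aut1. Qed.

Lemma group_autJ phi g k : phi (g ^ k)%g = (phi g ^ phi k)%g.
Proof. by rewrite !conjgE !group_autM group_autV. Qed.

Lemma cj_aut phi g h : cj g h -> cj (phi g) (phi h).
Proof.
case=> k [->|->]; exists (phi k); rewrite group_autJ ?group_autV; [by left|by right].
Qed.

(** By [card_Hom], the number of morphisms from the segment of [u], when it is
   folded, to the circle of [c]. *)
Definition hc u c : nat := cocc u c + cocc u (winv c).

Lemma hc_winv u c : hc u (winv c) = hc u c.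
Proof. by rewrite /hc winvK addnC. Qed.

Lemma hc_rcons u c : hc u c = \sum_(a : L) hc (rcons u a) c.
Proof. by rewrite big_split /= -!cocc_rcons. Qed.

Lemma cj_hc c d : cycred c -> cycred d -> cj (fg c) (fg d) ->
  size d = size c /\ forall u, hc u d = hc u c.
Proof.
move=> cR dR [k]; wlog: c cR / fg d = (fg c ^ k)%g => [IH|dE _].
  case=> dE; first by apply: IH => //; left.
  case: (IH (winv c)); rewrite ?cycred_winv ?fg_winv ?size_winv //; first by left.
  by move=> -> cc; split=> // u; rewrite cc hc_winv.
have [sz cc] := conjg_cocc cR dR dE; split=> // u; rewrite /hc cc; congr (_ + _).
have cR' : cycred (winv c) by rewrite cycred_winv.
have dR' : cycred (winv d) by rewrite cycred_winv.
have dE' : fg (winv d) = (fg (winv c) ^ k)%g by rewrite !fg_winv conjVg dE.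
by have [_ ->] := conjg_cocc cR' dR' dE'.
Qed.

Lemma rot_cj u c i : u = rot i c -> cj (fg c) (fg u).
Proof. by move=> ->; rewrite fg_rot; apply: cjJ. Qed.

(** The factor counts give the length of [c], by counting letters, and tell that
   [c] itself is read along [d]; this identifies the circles. *)
Lemma hc_eq_iso c d : cycred c -> cycred d ->
  (forall u, u != [::] -> word_reduced u -> hc u c = hc u d) ->
  giso (circle c) (circle d) /\ cj (fg c) (fg d).
Proof.
move=> cR dR cd.
have sum_hc w : \sum_(a : L) hc [:: a] w = size w * 2.
  by rewrite big_split /= !sum_cocc1 size_winv muln2 addnn.
have sz : size c = size d.
  apply/eqP; rewrite -(eqn_pmul2r (isT : 0 < 2)) -!sum_hc; apply/eqP.
  by apply: eq_bigr => a _; apply: cd.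
have c0 : c != [::] by case/andP: cR.
have H : 0 < hc c d by rewrite -cd ?cycred_reduced // addn_gt0 cocc_self.
split.
  move: H; rewrite /hc -card_reads card_gt0 => /set0Pn[e].
  by rewrite inE => /giso_reads; apply.
move: H; rewrite addn_gt0 => /orP[] /cocc_eq_rot.
  by case=> // i /rot_cj /cj_sym.
rewrite size_winv => /(_ sz)[i /rot_cj]; rewrite fg_winv => /cj_sym ?.
by apply: (cj_trans (h := (fg d)^-1%g)) => //; apply/cj_sym/cjV.
Qed.

Lemma uword_word (u : uword X) : (repr u : seq L) != [::] /\ word_reduced (repr u).
Proof. by case/andP: (valP (repr u)) => u0; rewrite folded_segment_reduced. Qed.

Lemma card_Hom_hc (u : folded_segment X) c : #|Hom (segment u) (circle c)| = hc u c.
Proof. by case/andP: (valP u) => u0 uF; rewrite card_Hom. Qed.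

Lemma hom_countE (u : uword X) (w : cword X) : hom_count u w = hc (repr u) (repr w).
Proof. exact: card_Hom_hc. Qed.

Lemma circ_iso_repr (c : folded_circle X) :
  giso (circle (repr (\pi_(cword X) c))) (circle c).
Proof. by have /eqmodP := reprK (\pi_(cword X) c). Qed.

Lemma seg_iso_repr (u : folded_segment X) :
  giso (segment (repr (\pi_(uword X) u))) (segment u).
Proof. by have /eqmodP := reprK (\pi_(uword X) u). Qed.

Lemma giso_hc c d u : giso (circle c) (circle d) -> u != [::] -> word_reduced u ->
  hc u c = hc u d.
Proof.
move=> cd u0; rewrite -folded_segment_reduced => uF.
by have := giso_card_Hom (segment u) cd; rewrite !card_Hom.
Qed.

Lemma hom_count_pi (u : uword X) (c : folded_circle X) :
  hom_count u (\pi_(cword X) c) = hc (repr u) c.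
Proof.
by have [u0 ur] := uword_word u; rewrite hom_countE (giso_hc (circ_iso_repr c)).
Qed.

Lemma hom_count_pi_seg (u : folded_segment X) (w : cword X) :
  hom_count (\pi_(uword X) u) w = hc u (repr w).
Proof.
rewrite -card_Hom_hc /hom_count /uword_graph /cword_graph.
have /gisoP[f [g [fH gH [f1K f2K] [g1K g2K]]]] := seg_iso_repr u.
have le (G H K : lgraph X) (p : gmap G H) (q : gmap H G) : p \in Hom G H ->
    cancel q.1 p.1 -> cancel q.2 p.2 -> #|Hom H K| <= #|Hom G K|.
  move=> pH p1K p2K; rewrite -(card_in_imset (f := fun r : gmap H K => gmap_comp r p)).
    by apply/subset_leq_card/subsetP => _ /imsetP[r rH ->]; apply: gmap_comp_Hom.
  move=> r r' _ _ [] /ffunP E1 /ffunP E2.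
  rewrite [r]surjective_pairing [r']surjective_pairing; congr pair.
    by apply/ffunP => x; have := E1 (q.1 x); rewrite !ffunE p1K.
  by apply/ffunP => x; have := E2 (q.2 x); rewrite !ffunE p2K.
by apply/eqP; rewrite eqn_leq; apply/andP; split; [apply: le gH _ _ | apply: le fH _ _].
Qed.

Lemma pi_circ_cj (c d : folded_circle X) :
  \pi_(cword X) c = \pi_(cword X) d <-> cj (fg c) (fg d).
Proof.
have cR := circle_cycred c; have dR := circle_cycred d; split.
  move/eqmodP=> cd; apply: (proj2 (hc_eq_iso cR dR _)) => u u0 ur; exact: giso_hc.
move=> cd; apply/eqmodP; apply: (proj1 (hc_eq_iso cR dR _)) => u u0 ur.
by rewrite (proj2 (cj_hc cR dR cd)).
Qed.

Lemma cword_sep (w1 w2 : cword X) :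
  (forall u : uword X, hom_count u w1 = hom_count u w2) -> w1 = w2.
Proof.
move=> E; rewrite -[w1]reprK -[w2]reprK; apply/pi_circ_cj.
apply: (proj2 (hc_eq_iso (circle_cycred _) (circle_cycred _) _)) => u u0 ur.
have uF : (u != [::]) && folded (segment u) by rewrite u0 folded_segment_reduced.
by have := E (\pi_(uword X) (FoldedSegment uF)); rewrite !hom_count_pi_seg.
Qed.

Lemma cyc_step_decomp w : exists h : seq L, w = h ++ cyc_step w ++ winv h.
Proof.
case: w => [|a s] /=; first by exists [::].
case: ifP => [/eqP E|_]; last by exists [::]; rewrite cats0.
case/lastP: s E => [/= /eqP|s b]; first by rewrite eq_sym linv_neq.
rewrite last_rcons => ->; exists [:: a].
by rewrite size_rcons /= -cats1 take_size_cat.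
Qed.

Lemma cyc_reduce_decomp w : exists h : seq L, w = h ++ cyc_reduce w ++ winv h.
Proof.
rewrite /cyc_reduce; elim: (size w) => [|n [h E]]; first by exists [::]; rewrite cats0.
have [h' E'] := cyc_step_decomp (iter n (@cyc_step X) w).
by exists (h ++ h'); rewrite iterS winv_cat {1}E {1}E' !catA.
Qed.

Lemma cj_cyc_reduce g : cj g (fg (cyc_reduce g)).
Proof.
have [h E] := cyc_reduce_decomp (val g).
move: (cyc_reduce _) E => c /(congr1 (@fg X)); rewrite val_fgK => ->.
exists (fg h); left; rewrite !fg_cat fg_winv conjgE.
by rewrite !mulgA mulVg mul1g mulgVK.
Qed.

Lemma circle_eltE (c : folded_circle X) : circle_elt c = fg c.
Proof. by apply: val_inj; rewrite fgK //; exact: (proj2 (folded_circle_word c)). Qed.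

Lemma cyclic_word_cj g h (g1 : g != 1%g) (h1 : h != 1%g) :
  cyclic_word g1 = cyclic_word h1 <-> cj g h.
Proof.
rewrite pi_circ_cj /=; split=> gh.
  apply: cj_trans (cj_cyc_reduce g) (cj_trans gh _); exact/cj_sym/cj_cyc_reduce.
apply: cj_trans (cj_sym (cj_cyc_reduce g)) (cj_trans gh _); exact/cj_cyc_reduce.
Qed.

(** The chosen representative of a cyclic word is known only up to conjugation and
   inversion. *)
Lemma repr_cyclic_word g (g1 : g != 1%g) : cj (circle_elt (repr (cyclic_word g1))) g.
Proof.
have := reprK (cyclic_word g1); rewrite {2}/cyclic_word => /pi_circ_cj.
rewrite circle_eltE => E; apply: cj_trans E _; exact/cj_sym/cj_cyc_reduce.
Qed.

Lemma cword_circle (w : cword X) : w = cyclic_word (circle_elt_neq1 (repr w)).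
Proof.
rewrite -{1}[w]reprK; apply/pi_circ_cj; rewrite /= -circle_eltE.
exact: cj_cyc_reduce (circle_elt (repr w)).
Qed.

Lemma cword_aut1 (w : cword X) : cword_aut 1%g w = w :> cword X.
Proof. by rewrite [RHS]cword_circle; apply/cyclic_word_cj/cj_refl. Qed.

Lemma cword_autM phi psi (w : cword X) :
  cword_aut (phi * psi)%g w = cword_aut phi (cword_aut psi w).
Proof. by apply/cyclic_word_cj/cj_aut/cj_sym/repr_cyclic_word. Qed.

Lemma cword_aut_out phi psi (w : cword X) : out_class phi = out_class psi ->
  cword_aut phi w = cword_aut psi w.
Proof.
move/out_classP/asboolP=> [k E]; apply/cyclic_word_cj.
have -> : phi = (inner k * psi)%g by rewrite -E mulgVK.
apply: cj_sym; exists k^-1%g; left.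
by rewrite conjgE invgK mulgA.
Qed.

Lemma cword_aut_fix phi : (forall w : cword X, cword_aut phi w = w) -> forall g, cj g (phi g).
Proof.
move=> fixw g; have [->|g1] := eqVneq g 1%g; first by rewrite group_aut1; apply: cj_refl.
have := fixw (cyclic_word g1); rewrite [RHS]cword_circle => /cyclic_word_cj E.
have G := repr_cyclic_word g1.
exact: cj_trans (cj_sym G) (cj_trans (cj_sym E) (cj_aut phi G)).
Qed.

End CyclicClasses.

(** * Automorphisms preserving every cyclic word *)

Section Pointwise.
Variable X : finType.
Local Notation L := (letter X).
Implicit Types (a b l : L) (u v w s t c d h : seq L) (g k : free_group X).
Implicit Types phi psi : group_aut (free_group X).

Lemma fg_cons a u : fg (a :: u) = (fg [:: a] * fg u)%g.
Proof. by rewrite -fg_cat. Qed.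

Lemma letter_eq a b : a.1 = b.1 -> a = b \/ a = linv b.
Proof.
case: a b => x i [y j] /= <-; rewrite /linv /=.
by case: i j => [] []; auto.
Qed.

Lemma letter_neq a b : a.1 != b.1 -> a <> b.
Proof. by move=> ab E; rewrite E eqxx in ab. Qed.

Lemma conj_letter a b : a.1 = b.1 -> (fg [:: a] ^ fg [:: b])%g = fg [:: a].
Proof.
by case/letter_eq=> ->; rewrite conjgE ?fg1V -?invgM ?mulgA ?mulVg ?mul1g ?mulgK ?mulgVK.
Qed.

Lemma conj_letters a h : all (fun l => l.1 == a.1) h ->
  (fg [:: a] ^ fg h)%g = fg [:: a].
Proof.
elim: h => [|l h IHh] /=; first by rewrite fg0 conjg1.
by case/andP=> /eqP la ah; rewrite (fg_cons l h) conjgM conj_letter // IHh.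
Qed.

Lemma conj_lettersV a h : all (fun l => l.1 == a.1) h ->
  (fg [:: a] ^ (fg h)^-1)%g = fg [:: a].
Proof. by move=> ah; rewrite -{1}(conj_letters ah) conjgK. Qed.

(** A conjugating word of minimal length does not end with a letter that commutes
   with the conjugated one. *)
Lemma cj_letter a g : cj (fg [:: a]) g ->
  exists h b, [/\ word_reduced h, forall s l, h = rcons s l -> l.1 != a.1,
    b.1 = a.1 & g = (fg [:: b] ^ (fg h)^-1)%g].
Proof.
have E w b : word_reduced w -> b.1 = a.1 -> exists h,
    [/\ word_reduced h, forall s l, h = rcons s l -> l.1 != a.1
      & (fg [:: b] ^ (fg w)^-1 = fg [:: b] ^ (fg h)^-1)%g].
  move=> + ba; elim/last_ind: w => [|w l IHw] wr.
    by exists [::]; split=> // s l /(congr1 size); rewrite size_rcons.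
  have [la | la] := eqVneq l.1 a.1; last first.
    by exists (rcons w l); split=> // s l' /rcons_inj[_ <-].
  have [|h [hr hl hE]] := IHw; first by move: wr; rewrite -cats1 => /reduced_catl.
  exists h; split=> //; rewrite -hE -cats1 fg_cat invgM conjgM -fg1V.
  by rewrite (@conj_letter b (linv l)) //= ba.
case=> k gk; have [b [ba ->]] : exists b, b.1 = a.1 /\ g = (fg [:: b] ^ k)%g.
  by case: gk => ->; [exists a | exists (linv a); rewrite fg1V].
have [h [hr hl hE]] := E (val k^-1%g) b (valP _) ba.
by exists h, b; split=> //; rewrite -hE val_fgK invgK.
Qed.

Lemma cycred2 a b : a.1 != b.1 -> cycred [:: a; b].
Proof.
move=> ab; rewrite /cycred /word_reduced /=.
by rewrite !andbT; apply/and3P; split; apply/eqP/letter_neq; rewrite //= eq_sym.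
Qed.

Lemma cycred_cons a s : word_reduced (rcons (a :: s) a) -> cycred (a :: s).
Proof.
rewrite -cats1 => sa; rewrite /cycred -[_ ++ _]/((a :: s) ++ [:: a] ++ s).
by rewrite reduced_glue // sa /=; move/reduced_catl: sa.
Qed.

(** Up to conjugation, [h] may be stripped of its initial letters that commute with
   [a]; if something is left, the product is spelled by a cyclically reduced word
   of length more than 2, while [a' b'] has length 2. *)
Lemma cj_pair a b a' b' h : a.1 != b.1 -> a'.1 != b'.1 -> word_reduced h ->
  (forall s l, h = rcons s l -> l.1 != b.1) ->
  cj (fg [:: a'; b']) (fg [:: a] * fg [:: b] ^ (fg h)^-1)%g ->
  all (fun l => l.1 == a.1) h.
Proof.
move=> ab ab' hr hb.
have [h1 [h2 [hE ah1 ah2]]] : exists h1 h2, [/\ h = h1 ++ h2,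
    all (fun l => l.1 == a.1) h1 & forall l s, h2 = l :: s -> l.1 != a.1].
  elim: (h) => [|l s [h1 [h2 [-> ah1 ah2]]]]; first by exists [::], [::].
  have [la | la] := boolP (l.1 == a.1).
    by exists (l :: h1), h2; split=> //=; rewrite la.
  by exists [::], (l :: h1 ++ h2); split=> // l' s' [<-].
have -> : (fg [:: a] * fg [:: b] ^ (fg h)^-1 =
           (fg [:: a] * fg [:: b] ^ (fg h2)^-1) ^ (fg h1)^-1)%g.
  by rewrite conjMg (conj_lettersV ah1) -conjgM -invgM -fg_cat -hE.
case: h2 hE ah2 => [-> _ _|l s]; first by rewrite cats0.
set h2 := l :: s => hE /(_ l s erefl) la cjE; exfalso.
have h2r : word_reduced h2 by move: hr; rewrite hE => /reduced_catr.
have [t [m h2E]] : exists t m, h2 = rcons t m.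
  by exists (belast l s), (last l s); rewrite -lastI.
have mb : m.1 != b.1 by apply: (hb (h1 ++ t)); rewrite hE h2E rcons_cat.
pose d := a :: h2 ++ b :: winv h2.
have dR : cycred d.
  apply: cycred_cons.
  have -> : rcons d a = rcons (a :: t) m ++ b :: rcons (winv h2) a.
    by rewrite rcons_cons -h2E /d -!cats1 -!cat_cons -catA.
  rewrite reduced_rcons_cons; apply/and3P; split.
  - rewrite rcons_cons -h2E -[a :: h2]/(rcons [::] a ++ l :: s) reduced_rcons_cons.
    by rewrite h2r andbT; apply/eqP/letter_neq.
  - by apply/eqP/letter_neq; rewrite eq_sym.
  rewrite h2E winv_rcons -[b :: _]/(rcons [::] b ++ linv m :: rcons (winv t) a).
  rewrite reduced_rcons_cons -rcons_cons -winv_rcons -h2E; apply/and3P; split=> //.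
    by apply/eqP/letter_neq.
  rewrite -cats1 winv_cons reduced_rcons_cons -winv_cons reduced_winvE h2r andbT.
  by apply/eqP/letter_neq; rewrite eq_sym.
have dE : fg d = (fg [:: a] * fg [:: b] ^ (fg h2)^-1)%g.
  by rewrite /d (fg_cons a (h2 ++ _)) fg_cat (fg_cons b (winv _)) fg_winv conjgE invgK.
have : cj (fg [:: a'; b']) (fg d).
  by apply: cj_trans cjE _; rewrite -dE; apply/cj_sym/cjJ.
case/(cj_hc (cycred2 ab') dR) => /eqP; rewrite /d /h2 /= size_cat /= size_winv /=.
by lia.
Qed.

Lemma cj_rot c d : cycred c -> cycred d -> cj (fg c) (fg d) ->
  exists i, d = rot i c \/ d = rot i (winv c).
Proof.
move=> cR dR; have d0 : d != [::] by case/andP: dR.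
have E w : cycred w -> forall k, fg d = (fg w ^ k)%g -> exists i, d = rot i w.
  move=> wR k /(conjg_cocc wR dR)[sz cc].
  by apply: cocc_eq_rot sz _; rewrite -cc cocc_self.
case=> k [/(E c cR)[i ->]|]; first by exists i; left.
rewrite -fg_winv => /E[|i ->]; first by rewrite cycred_winv.
by exists i; right.
Qed.

Lemma cj_sign a b a' b' : a.1 != b.1 -> a'.1 = a.1 -> b'.1 = b.1 ->
  cj (fg [:: a; b]) (fg [:: a'; b']) ->
  (a' = a /\ b' = b) \/ (a' = linv a /\ b' = linv b).
Proof.
move=> ab a'a b'b; have ab' : a'.1 != b'.1 by rewrite a'a b'b.
have a'b : a' <> b by apply: letter_neq; rewrite a'a.
have a'b' : a' <> linv b by apply: letter_neq; rewrite a'a.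
case/(cj_rot (cycred2 ab) (cycred2 ab')) => -[|[|i]] []; rewrite /rot /winv /=;
  case; by [move=> /a'b | move=> /a'b' | auto].
Qed.

(** Inverting both letters of a word gives the inverse of its reversal, and [aababb]
   is not a cyclic permutation of its reversal [bbabaa]. *)
Lemma not_cj_linv a b : a.1 != b.1 ->
  ~ cj (fg [:: a; a; b; a; b; b])
       (fg [:: linv a; linv a; linv b; linv a; linv b; linv b]).
Proof.
move=> ab.
have n1 : linv a <> linv b by apply: letter_neq.
have n2 : linv a <> b by apply: letter_neq.
have n3 : linv b <> a by apply: letter_neq; rewrite /= eq_sym.
have n4 : linv a <> a by apply/eqP; rewrite linv_neq.
have n5 : linv b <> b by apply/eqP; rewrite linv_neq.
have n6 : a.1 <> b.1 by apply/eqP.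
have n7 : a <> b by apply: letter_neq.
have cR : cycred [:: a; a; b; a; b; b].
  rewrite /cycred /word_reduced /=; repeat (apply/andP; split) => //; apply/eqP; congruence.
have dR : cycred [:: linv a; linv a; linv b; linv a; linv b; linv b].
  rewrite /cycred /word_reduced /= !linvK.
  repeat (apply/andP; split) => //; apply/eqP; congruence.
case/(cj_rot cR dR) => -[|[|[|[|[|[|i]]]]]] [];
  rewrite /rot /winv /=; case; congruence.
Qed.

Lemma inner_shift phi k : is_inner (inner k * phi)%g -> is_inner phi.
Proof.
move=> kphi; have -> : phi = ((inner k)^-1 * (inner k * phi))%g by rewrite mulKg.
by apply: is_innerM kphi; apply: is_innerV; apply/asboolP; exists k.
Qed.

Lemma innerM_conj phi k g : (inner k^-1 * phi)%g g = (phi g ^ k)%g.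
Proof.
rewrite -[LHS]/(inner_fun k^-1 (phi g))%g.
by rewrite /inner_fun invgK conjgE mulgA.
Qed.

Lemma cj_innerM phi k : (forall g, cj g (phi g)) -> forall g, cj g ((inner k^-1 * phi)%g g).
Proof. by move=> H g; rewrite innerM_conj; apply: cj_trans (H g) (cjJ _ _). Qed.

Lemma aut_fix_letters phi : (forall x, phi (fg [:: (x, true)]) = fg [:: (x, true)]) ->
  is_inner phi.
Proof.
move=> fixx; suff -> : phi = 1%g by apply: is_inner1.
apply: group_autP => g; rewrite -[g]val_fgK; elim: (val g) => [|a u IHu].
  by rewrite fg0 group_aut1.
rewrite (fg_cons a u) group_autM IHu; congr (_ * _)%g.
case: a => x [] //; rewrite -[(x, false)]/(linv (x, true)) fg1V group_autV fixx //.
Qed.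

(** After composition with an inner automorphism, two generators [a] and [b] are
   mapped to [a^+-1] and [b^+-1]; the images of [ab] and of [aababb] force both
   signs to be positive.  The image of any other generator is conjugate to it or
   to its inverse by an element that is both a power of [a] and a power of [b],
   hence trivial, and its sign is that of [a]. *)
Lemma pointwise_inner phi (x1 x2 : X) : x1 != x2 ->
  (forall g, cj g (phi g)) -> is_inner phi.
Proof.
move=> x12; pose a : L := (x1, true); pose b : L := (x2, true).
have ab : a.1 != b.1 by [].
have fg2 (c d : L) : fg [:: c; d] = (fg [:: c] * fg [:: d])%g by rewrite -fg_cat.
wlog [a' a'a phia] : phi / exists2 a' : L, a'.1 = a.1 & phi (fg [:: a]) = fg [:: a'].
  move=> IH cjphi; have [h [a' [_ _ a'a E]]] := cj_letter (cjphi (fg [:: a])).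
  apply: (@inner_shift _ (fg h)^-1%g); apply: IH; last exact: cj_innerM.
  by exists a'; rewrite // innerM_conj E conjgKV.
move=> cjphi.
wlog [b' b'b phib] : phi phia cjphi / exists2 b' : L, b'.1 = b.1 & phi (fg [:: b]) = fg [:: b'].
  move=> IH; have [h [b' [hr hb b'b E]]] := cj_letter (cjphi (fg [:: b])).
  have ha : all (fun l => l.1 == a'.1) h.
    apply: (cj_pair (a' := a) (b' := b) (b := b')); rewrite ?a'a ?b'b //.
    by have := cjphi (fg [:: a; b]); rewrite fg2 group_autM phia E.
  apply: (@inner_shift _ (fg h)^-1%g); apply: IH; last 2 first.
  - exact: cj_innerM.
  - by exists b'; rewrite // innerM_conj E conjgKV.
  by rewrite innerM_conj phia conj_letters.
have /(cj_sign ab a'a b'b) : cj (fg [:: a; b]) (fg [:: a'; b']).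
  by have := cjphi (fg [:: a; b]); rewrite !fg2 group_autM phia phib.
case=> -[aE bE]; last first.
  exfalso; apply: (not_cj_linv ab); rewrite -aE -bE.
  have split6 (c d : L) : fg [:: c; c; d; c; d; d] =
      (fg [:: c] * fg [:: c] * fg [:: d] * fg [:: c] * fg [:: d] * fg [:: d])%g.
    by rewrite -!fg_cat.
  by have := cjphi (fg [:: a; a; b; a; b; b]); rewrite !split6 !group_autM phia phib.
rewrite {a'}aE {b'}bE in a'a b'b phia phib.
(* The conjugator of another generator has only letters of the type of [a] and only
   letters of the type of [b], so it is empty. *)
apply: aut_fix_letters => x; pose c : L := (x, true).
have [-> // | xx1] := eqVneq x x1; have [-> // | xx2] := eqVneq x x2.
have [h [c' [hr hc c'c E]]] := cj_letter (cjphi (fg [:: c])).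
have ac : a.1 != c.1 by rewrite eq_sym.
have bc : b.1 != c.1 by rewrite eq_sym.
have ha : all (fun l => l.1 == a.1) h.
  apply: (cj_pair (a' := a) (b' := c) (b := c')); rewrite ?c'c //.
  by have := cjphi (fg [:: a; c]); rewrite fg2 group_autM phia E.
have hb : all (fun l => l.1 == b.1) h.
  apply: (cj_pair (a' := b) (b' := c) (b := c')); rewrite ?c'c //.
  by have := cjphi (fg [:: b; c]); rewrite fg2 group_autM phib E.
have h0 : h = [::].
  case: (h) ha hb => [//|l s] /= /andP[/eqP la _] /andP[/eqP lb _].
  by have := x12; rewrite -[x1]la -[x2]lb eqxx.
move: E; rewrite h0 fg0 invg1 conjg1 => E; rewrite -/c E.
have /(cj_sign ac erefl c'c) : cj (fg [:: a; c]) (fg [:: a; c']).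
  by have := cjphi (fg [:: a; c]); rewrite !fg2 group_autM phia E.
case=> [[_ ->] //|[/eqP]]; by rewrite eq_sym linv_neq.
Qed.

End Pointwise.

(** * Bounded cancellation and occurrences in images *)

Section Locality.
Variable X : finType.
Local Notation L := (letter X).
Local Open Scope quotient_scope.
Implicit Types (a b x : L) (u v w s t c h p q y : seq L) (g k : free_group X).
Implicit Types phi : group_aut (free_group X).

Lemma size_fg u : size (fg u : seq L) <= size u.
Proof.
elim: u => [//|a u IHu]; rewrite -cat1s fg_cat.
by apply: leq_trans (size_mul _ _) _; rewrite size_cat leq_add.
Qed.

Section Automorphism.
Variable phi : group_aut (free_group X).

Definition img u : seq L := val (phi (fg u)).

Lemma fg_img u : fg (img u) = phi (fg u). Proof. exact: val_fgK. Qed.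

Lemma reduced_img u : word_reduced (img u). Proof. exact: valP. Qed.

Lemma img_cat u v : fg (img (u ++ v)) = (fg (img u) * fg (img v))%g.
Proof. by rewrite !fg_img fg_cat group_autM. Qed.

Lemma img_winv u : img (winv u) = winv (img u).
Proof. by rewrite /img fg_winv group_autV. Qed.

Lemma img_eq u s : word_reduced s -> fg (img u) = fg s -> img u = s.
Proof. by move=> sr /(congr1 val); rewrite !fgK // reduced_img. Qed.

Lemma size_img : exists C, forall u, size (img u) <= C * size u.
Proof.
exists (\max_(a : L) size (img [:: a])); elim=> [|a u IHu].
  by rewrite muln0 /img fg0 group_aut1.
rewrite -cat1s /img fg_cat group_autM; apply: leq_trans (size_mul _ _) _.
by rewrite size_cat mulnDr muln1 leq_add // (bigD1 a) //= leq_maxl.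
Qed.

End Automorphism.

Lemma size_img_inv phi : exists C, forall u, word_reduced u -> size u <= C * size (img phi u).
Proof.
have [C HC] := size_img (phi^-1)%g; exists C => u ur; have := HC (img phi u).
have -> : img phi^-1%g (img phi u) = u; last by [].
apply: img_eq => //; rewrite !fg_img.
by rewrite -[LHS]/((phi^-1 * phi)%g (fg u)) mulVg.
Qed.

(** The images of the prefixes of [h] make a path of bounded step from 1 to the image
   of [h] in the Cayley tree, so they pass near each point [t] of the geodesic. *)
Lemma img_prefix_near phi C h t : (forall u, size (img phi u) <= C * size u) ->
  prefix t (img phi h) -> exists h1 h2,
    h = h1 ++ h2 /\ size (val ((fg t)^-1 * fg (img phi h1))%g) <= C.
Proof.
move=> HC; elim/last_ind: h => [|h x IHh].
  rewrite /img fg0 group_aut1 prefixs0 => /eqP->.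
  by exists [::], [::]; rewrite fg0 group_aut1 fg0 mulVg.
have [p [s [q [hE xE pq]]]] := cancellation (reduced_img phi h) (reduced_img phi [:: x]).
have -> : img phi (rcons h x) = p ++ q.
  apply: img_eq => //; rewrite -cats1 img_cat hE xE !fg_cat fg_winv.
  by rewrite mulgA mulgVK.
have [le_tp|lt_pt] := leqP (size t) (size p).
  rewrite prefix_cat_long // => tp.
  have [|h1 [h2 [-> th1]]] := IHh; first by rewrite hE prefix_cat_long.
  by exists h1, (rcons h2 x); rewrite rcons_cat.
case/prefixP=> z pqE; exists (rcons h x), [::]; rewrite cats0; split=> //.
have -> : fg (img phi (rcons h x)) = fg (t ++ z).
  by rewrite -pqE -cats1 img_cat hE xE !fg_cat fg_winv mulgA mulgVK.
rewrite fg_cat mulKg; apply: leq_trans (size_fg z) _.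
have := HC [:: x]; rewrite xE size_cat muln1 => le_C.
rewrite -(leq_add2l (size t)) -size_cat -pqE size_cat; lia.
Qed.

(** Bounded cancellation: if the images of [g] and [h] cancel along [t], then [t] is
   near the image of a prefix [g1] of [g^-1] and near that of a prefix [h1] of
   [h].  As [g1^-1 h1] is reduced and its image is short, [h1] is short too. *)
Lemma bounded_cancellation phi : exists B, forall g h : seq L, word_reduced (g ++ h) ->
  exists p t q, [/\ img phi g = p ++ winv t, img phi h = t ++ q,
    word_reduced (p ++ q) & size t <= B].
Proof.
have [C HC] := size_img phi; have [C' HC'] := size_img_inv phi.
(* [C' * (C + C)] bounds [h1], and [t] is within [C] of the image of [h1]. *)
exists (C * (C' * (C + C)) + C) => g h ghr.
have [p [t [q [gE hE pq]]]] := cancellation (reduced_img phi g) (reduced_img phi h).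
exists p, t, q; split=> //.
have [|g1 [g2 [g12 tg1]]] := @img_prefix_near phi C (winv g) t HC.
  by rewrite img_winv gE winv_cat winvK prefix_prefix.
have [|h1 [h2 [h12 th1]]] := @img_prefix_near phi C h t HC.
  by rewrite hE prefix_prefix.
have r1 : word_reduced (winv g1 ++ h1).
  move: ghr; rewrite -[g]winvK g12 winv_cat h12 catA.
  by move/reduced_catl; rewrite -catA => /reduced_catr.
have s1 : size (img phi (winv g1 ++ h1)) <= C + C.
  have -> : img phi (winv g1 ++ h1) =
      val (((fg t)^-1 * fg (img phi g1))^-1 * ((fg t)^-1 * fg (img phi h1)))%g.
    rewrite -[LHS]/(val (phi _)) -fg_img img_cat img_winv fg_winv.
    by rewrite invgM invgK mulgA mulgK.
  apply: leq_trans (size_mul _ _) _; rewrite val_inv size_winv; exact: leq_add.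
have s2 : size h1 <= C' * (C + C).
  have := HC' _ r1; rewrite size_cat => le1.
  by have := leq_mul (leqnn C') s1; lia.
have s3 : size t <= size (img phi h1) + C.
  have tr : word_reduced t by move: (reduced_img phi h); rewrite hE => /reduced_catl.
  have {1}-> : t = val (fg (img phi h1) * ((fg t)^-1 * fg (img phi h1))^-1)%g.
    by rewrite invgM invgK mulgA mulgV mul1g fgK.
  apply: leq_trans (size_mul _ _) _; rewrite val_inv size_winv leq_add //.
  exact: leq_trans (size_fg _) _.
by have := HC h1; have := leq_mul (leqnn C) s2; lia.
Qed.

(** The image of a long [q] keeps a part of length at least [size u] that is reached
   by cancellation neither from [y] nor from [h]; no occurrence of [u]
   extends beyond it on both sides, so the effects of [y] and of [h] add up. *)
Lemma img_local phi u : exists2 N, 0 < N & forall y q h, word_reduced (y ++ q ++ h) ->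
  N <= size q ->
  occ u (img phi (y ++ q ++ h)) + occ u (img phi q) =
  occ u (img phi (y ++ q)) + occ u (img phi (q ++ h)).
Proof.
have [B HB] := bounded_cancellation phi; have [C HC] := size_img_inv phi.
(* Cancellation removes at most [B] letters at each end of the image of [q]. *)
pose K := B + B + (size u).+1.
exists (C * K).+1 => // y q h r le_q.
have q0 : q != [::] by case: (q) le_q.
move: (r); rewrite reduced_glue // => /andP[yq qh].
have [p [t [q1 [yE qE pq1 tB]]]] := HB _ _ yq.
have [p' [t' [q2 [qE' hE pq2 tB']]]] := HB _ _ qh.
have qr := reduced_catr yq.
have Kq : K <= size (img phi q).
  rewrite leqNgt; apply/negP => lt_K; have := HC _ qr.
  by have := leq_mul (leqnn C) (ltnW lt_K); lia.
have szp : size t + size u < size p'.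
  by move: Kq; rewrite qE' size_cat size_winv /K; lia.
have [m p'E] : exists m, p' = t ++ m.
  exists (drop (size t) p'); rewrite -{1}(cat_take_drop (size t) p'); congr (_ ++ _).
  have := congr1 (take (size t)) (etrans (esym qE') qE).
  rewrite takel_cat; last by lia.
  by rewrite take_size_cat // => ->.
have q1E : q1 = m ++ winv t'.
  by have := etrans (esym qE) qE'; rewrite p'E -catA => /eqP; rewrite eqseq_cat // => /andP[_ /eqP].
have um : size u < size m by move: szp; rewrite p'E size_cat; lia.
have m0 : m != [::] by rewrite -size_eq0 -lt0n (leq_trans _ um).
have pmr : word_reduced (p ++ m ++ q2).
  rewrite reduced_glue //; apply/andP; split.
    by move: pq1; rewrite q1E catA => /reduced_catl.
  by move: pq2; rewrite p'E -catA => /reduced_catr.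
have -> : img phi (y ++ q ++ h) = p ++ m ++ q2.
  apply: img_eq => //; rewrite !img_cat yE hE qE q1E !fg_cat !fg_winv.
  by rewrite !mulgA mulgVK mulgVK.
have -> : img phi (y ++ q) = p ++ m ++ winv t'.
  by apply: img_eq; rewrite -?q1E // img_cat yE qE !fg_cat fg_winv mulgA mulgVK.
have -> : img phi (q ++ h) = t ++ m ++ q2.
  apply: img_eq; first by rewrite catA -p'E.
  by rewrite img_cat qE' hE p'E !fg_cat fg_winv !mulgA mulgVK.
rewrite qE q1E.
have := occ_overlap p q2 (ltnW um); have := occ_overlap p (winv t') (ltnW um).
have := occ_overlap t q2 (ltnW um); have := occ_overlap t (winv t') (ltnW um).
lia.
Qed.

(** The minimum is over a set that shrinks when [g] is extended to the left, so [f]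
   is monotonic, unlike the number of occurrences in the image of [g] itself. *)
Lemma stable_occ phi u : exists f : seq L -> nat, forall g : seq L, word_reduced g ->
  (forall y, word_reduced (y ++ g) -> f g <= occ u (img phi (y ++ g))) /\
  exists2 y, word_reduced (y ++ g) & f g = occ u (img phi (y ++ g)).
Proof.
suff ex (g : seq L) : exists n, word_reduced g ->
    (forall y, word_reduced (y ++ g) -> n <= occ u (img phi (y ++ g))) /\
    exists2 y, word_reduced (y ++ g) & n = occ u (img phi (y ++ g)).
  by have [f Hf] := choice ex; exists f.
have [gr|] := boolP (word_reduced g); last by exists 0.
pose P n := `[< exists2 y, word_reduced (y ++ g) & n = occ u (img phi (y ++ g)) >].
have exP : exists n, P n by exists (occ u (img phi g)); apply/asboolP; exists [::].
have [n /asboolP Pn nmin] := ex_minnP exP.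
exists n => _; split=> // y yr; apply: nmin; apply/asboolP; by exists y.
Qed.

(** The weight [D] of [x q], for [q] of length [N], is the increment from [q] to [x q]
   of the function of [stable_occ]: it is nonnegative by monotonicity, and by
   locality it is also the increment from [q g] to [x q g] for any [g].  Along
   one more period of [w] these increments add up to the number of occurrences
   of [u] gained in the image, which is the count for one period of [c]. *)
Lemma cocc_img phi u : exists N (D : seq L -> nat), forall w c h,
  cycred w -> cycred c -> word_reduced (h ++ c ++ winv h) ->
  phi (fg w) = fg (h ++ c ++ winv h) ->
  cocc u c = \sum_(v : N.+1.-tuple L) D v * cocc v w.
Proof.
have [N N0 loc] := img_local phi u; have [f fP] := stable_occ phi u.
have f_le (g : seq L) y : word_reduced (y ++ g) -> f g <= occ u (img phi (y ++ g)).
  by move=> yg; have [H _] := fP g (reduced_catr yg); apply: H.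
have f_loc q (g : seq L) : word_reduced (q ++ g) -> N <= size q ->
    f (q ++ g) + occ u (img phi q) = f q + occ u (img phi (q ++ g)).
  move=> qg Nq; have q0 : q != [::] by rewrite -size_eq0 -lt0n (leq_trans N0).
  have [_ [y ygr yE]] := fP _ qg; have [_ [z zr zE]] := fP _ (reduced_catl qg).
  have zgr : word_reduced (z ++ q ++ g) by rewrite reduced_glue // zr.
  have := loc _ _ _ ygr Nq; have := loc _ _ _ zgr Nq.
  have := f_le _ _ zgr; have := f_le q y.
  by move: ygr; rewrite catA => /reduced_catl -> /(_ isT); rewrite -catA; lia.
pose D v := if v is x :: q then f v - f q else 0.
have f_incr x q (g : seq L) : word_reduced (x :: q ++ g) -> size q = N ->
    f (x :: q ++ g) = D (x :: q) + f (q ++ g).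
  move=> r Nq; have q0 : q != [::] by rewrite -size_eq0 -lt0n Nq.
  have qg := reduced_behead r.
  have xq : word_reduced (x :: q) by move: r; rewrite -cat_cons => /reduced_catl.
  have [_ [y yr yE]] := fP _ xq.
  have le : f q <= f (x :: q).
    by rewrite yE -cat1s catA; apply: f_le; rewrite -catA.
  have := @f_loc q g qg; rewrite Nq => /(_ (leqnn _)).
  have := @f_loc (x :: q) g r; rewrite /= Nq => /(_ (leqnSn _)).
  have := loc [:: x] q g r; rewrite Nq => /(_ (leqnn _)) /=.
  by rewrite /D; lia.
exists N, D => w c h wR cR hcr phiw.
have c0 : c != [::] by case/andP: cR.
have w0 : w != [::] by case/andP: wR.
have sc : 0 < size c by rewrite lt0n size_eq0.
have sw : 0 < size w by rewrite lt0n size_eq0.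
have imgw m : img phi (cpow w m.+1) = h ++ cpow c m.+1 ++ winv h.
  apply: img_eq.
    have cm0 n : cpow c n.+1 != [::] by rewrite -size_eq0 size_cpow muln_eq0 -lt0n; lia.
    move: hcr; rewrite reduced_glue // => /andP[hc ch].
    rewrite reduced_glue // cpowS reduced_glue // hc -cpowS reduced_cpow //=.
    by rewrite cpowSr -catA reduced_glue // ch -cpowSr reduced_cpow.
  rewrite fg_img fg_cpow (fg_cat h) (fg_cat (cpow _ _)) fg_winv fg_cpow.
  have phiX g n : phi (g ^+ n)%g = (phi g ^+ n)%g.
    by elim: n => [|n IHn]; rewrite ?expg0 ?group_aut1 // !expgS group_autM IHn.
  rewrite phiX phiw !fg_cat fg_winv.
  have E g : (fg h * (g / fg h))%g = (g ^ (fg h)^-1)%g by rewrite conjgE invgK.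
  by rewrite !E conjXg.
(* The power [w ^ m] starts with [w ^ N], and both [c ^ m] and [w ^ m] are long
   enough for the occurrences of [u] and of the words of length [N.+1]. *)
pose m := N + size u + 1.
have um : size u <= size (cpow c m) by rewrite size_cpow; have := leq_pmulr m sc; lia.
have Nm : N < size (cpow w m) by rewrite size_cpow; have := leq_pmulr m sw; lia.
have occE : occ u (img phi (w ++ cpow w m)) = cocc u c + occ u (img phi (cpow w m)).
  have mE : m = (N + size u).+1 by rewrite /m addn1.
  by rewrite -cpowS imgw occ_period2 // mE -imgw.
have fE : f (w ++ cpow w m) = cocc u c + f (cpow w m).
  have Nq : N <= size (cpow w N) by rewrite size_cpow leq_pmulr.
  have wE : cpow w m = cpow w N ++ cpow w (size u + 1) by rewrite -cpowD /m addnA.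
  have wE' : w ++ cpow w m = cpow w N ++ cpow w (size u + 1).+1.
    by rewrite -cpowS -cpowD; congr cpow; rewrite /m; lia.
  have := @f_loc (cpow w N) (cpow w (size u + 1).+1); rewrite -wE' -cpowS.
  have := @f_loc (cpow w N) (cpow w (size u + 1)); rewrite -wE.
  rewrite !reduced_cpow // => /(_ isT Nq) E1 /(_ isT Nq) E2.
  by move: occE; rewrite -cpowS; lia.
have sumE s t : word_reduced (s ++ t) -> N < size t ->
    f (s ++ t) = \sum_(i < size s) D (take N.+1 (drop i (s ++ t))) + f t.
  move=> + Nt; elim: s => [|a s IHs] r; first by rewrite big_ord0.
  rewrite big_ord_recl /= -addnA -IHs ?(reduced_behead r) //.
  have := f_incr a (take N (s ++ t)) (drop N (s ++ t)).
  rewrite cat_take_drop; apply=> //.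
  by rewrite size_takel // size_cat; lia.
have wr : word_reduced (w ++ cpow w m) by rewrite -cpowS reduced_cpow.
have : cocc u c = \sum_(i < size w) D (take N.+1 (drop i (w ++ cpow w m))).
  by apply/eqP; rewrite -(eqn_add2r (f (cpow w m))) -fE -sumE.
move=> ->.
have coccN (v : N.+1.-tuple L) : cocc v w =
    \sum_(i < size w) prefix v (drop i (w ++ cpow w m)).
  by rewrite (@coccE _ _ _ m [::]) ?cats0 // size_tuple.
under [RHS]eq_bigr => v _ do rewrite coccN big_distrr /=.
rewrite exchange_big /=; apply: eq_bigr => i _.
set s := drop i _; have Ns : size (take N.+1 s) == N.+1.
  by rewrite size_takel // /s size_drop size_cat; have := ltn_ord i; lia.
rewrite (bigD1 (Tuple Ns)) //= prefixE (eqP Ns) eqxx muln1 big1 ?addn0 // => v.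
by rewrite prefixE size_tuple eq_sym -val_eqE /= => /negPf->; rewrite muln0.
Qed.

Lemma cocc_reduced v w : cycred w -> ~~ word_reduced v -> cocc v w = 0.
Proof.
move=> wR vr; apply: big1 => i _; apply/eqP; rewrite eqb0; apply: contra vr.
case/prefixP=> z E; have := reduced_cpow (size v).+1 wR.
by rewrite -(cat_take_drop i (cpow _ _)) => /reduced_catr; rewrite E => /reduced_catl.
Qed.

Theorem counts_preimages_ex phi (u : uword X) : exists S, counts_preimages phi u S.
Proof.
have [N [D HD]] := cocc_img phi (repr u).
pose mk (v : seq L) : seq (uword X) :=
  if insub v is Some u' then nseq (D v) (\pi_(uword X) (u' : folded_segment X)) else [::].
exists (flatten [seq mk (val v) | v : N.+1.-tuple L]) => w.
rewrite big_flatten big_map big_enum /=.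
pose r := circle_elt (repr w).
have phir : phi r != 1%g by apply: group_aut_neq1; apply: circle_elt_neq1.
pose c := cyc_reduce (phi r); have wR := circle_cycred (repr w).
have cR : cycred c by rewrite cycredE; apply: cyc_reduce_folded.
have [h hE] := cyc_reduce_decomp (val (phi r)).
have hr : word_reduced (h ++ c ++ winv h) by rewrite -hE; apply: valP.
have phiE : phi (fg (repr w)) = fg (h ++ c ++ winv h).
  by rewrite -hE val_fgK /r circle_eltE.
have hwE : winv (h ++ c ++ winv h) = h ++ winv c ++ winv h.
  by rewrite !winv_cat winvK catA.
rewrite hom_count_pi -[hc _ _]/(cocc _ c + cocc _ (winv c)).
rewrite (HD (repr w) c h) // (HD (winv (repr w)) (winv c) h) ?cycred_winv //; last 2 first.
- by rewrite -hwE reduced_winvE.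
- by rewrite -hwE fg_winv fg_winv group_autV phiE.
rewrite -big_split /=; apply: eq_bigr => v _; rewrite -mulnDr -[X in _ * X]/(hc v (repr w)).
rewrite /mk; case: insubP => [v' _ vE|].
  by rewrite big_nseq iter_addn_0 mulnC hom_count_pi_seg vE.
rewrite folded_segment_reduced -size_eq0 size_tuple /= big_nil => vr.
by rewrite /hc !cocc_reduced ?cycred_winv ?muln0.
Qed.

End Locality.

(** * The action on the inverse limit *)

Section Factor.
Import GRing.Theory.
Local Open Scope ring_scope.

(** The value at [a] is that of [g] at any preimage of [a]. *)
Lemma additive_factor (Z A B : zmodType) (f : {additive Z -> A}) (g : {additive Z -> B}) :
  (forall a, exists z, f z = a) -> (forall z, f z = 0 -> g z = 0) ->
  exists h : {additive A -> B}, forall z, h (f z) = g z.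
Proof.
move=> /choice[s sK] fg; pose h a := g (s a).
have hE z : h (f z) = g z.
  by apply/eqP; rewrite -subr_eq0 -raddfB fg // raddfB sK subrr.
have hB : {morph h : x y / x - y}.
  by move=> x y; rewrite -{1}(sK x) -{1}(sK y) -raddfB hE raddfB.
pose H : {additive A -> B} := HB.pack h (GRing.isZmodMorphism.Build A B h hB).
by exists H.
Qed.

End Factor.

Section Limit.
Import GRing.Theory.
Local Open Scope ring_scope.
Local Open Scope quotient_scope.
Variable X : finType.
Local Notation L := (letter X).
Implicit Types (u : uword X) (v : limM X) (w : cword X) (z : ZC X) (k m : nat).
Implicit Types phi psi : group_aut (free_group X).

Lemma pi_map_is_additive k : {morph @pi_map X k : y z / y - z}.
Proof. exact: lift_is_additive. Qed.

HB.instance Definition _ k :=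
  GRing.isZmodMorphism.Build (ZC X) (M X k) (@pi_map X k) (@pi_map_is_additive k).

Lemma tpi_is_additive k : {morph @tpi X k : y z / y - z}.
Proof. by move=> y z; apply: val_inj; rewrite /= raddfB. Qed.

HB.instance Definition _ k :=
  GRing.isZmodMorphism.Build (ZC X) (tM X k) (@tpi X k) (@tpi_is_additive k).

Lemma ZC_aut_is_additive phi : {morph @ZC_aut X phi : y z / y - z}.
Proof. exact: lift_is_additive. Qed.

HB.instance Definition _ phi :=
  GRing.isZmodMorphism.Build (ZC X) (ZC X) (ZC_aut phi) (@ZC_aut_is_additive phi).

Lemma tpi_surj k (t : tM X k) : exists z, tpi k z = t.
Proof. by have /asboolP[z zt] := valP t; exists z; apply: val_inj. Qed.

Lemma ZC_sumE z : z = \sum_(w <- dom z) << w >> *~ coeff w z.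
Proof.
by rewrite -[LHS]freeg_sumE; apply: eq_bigr => w _; rewrite freegU_mulz intz.
Qed.

Lemma ZC_additive_eq (A : zmodType) (f g : {additive ZC X -> A}) :
  (forall w, f << w >> = g << w >>) -> f =1 g.
Proof.
move=> fg z; rewrite (ZC_sumE z) !raddf_sum; apply: eq_bigr => w _.
by rewrite !raddfMz fg.
Qed.

Definition ev (F : cword X -> nat) : ZC X -> int :=
  fglift (fun w => (F w)%:Z : int^o).

Lemma ev_is_additive F : {morph ev F : y z / y - z}.
Proof. exact: (lift_is_additive (fun w => (F w)%:Z : int^o)). Qed.

HB.instance Definition _ F :=
  GRing.isZmodMorphism.Build (ZC X) int (ev F) (@ev_is_additive F).

Lemma evU F w : ev F << w >> = (F w)%:Z.
Proof. by rewrite /ev liftU scale1r. Qed.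

Lemma evE F z : ev F z = \sum_(w <- dom z) (F w)%:Z *~ coeff w z.
Proof.
rewrite {1}(ZC_sumE z) raddf_sum; apply: eq_bigr => w _.
by rewrite raddfMz /= evU.
Qed.

Lemma ev_sum (I : Type) (r : seq I) (F : I -> cword X -> nat) z :
  ev (fun w => \sum_(i <- r) F i w)%N z = \sum_(i <- r) ev (F i) z.
Proof.
under [RHS]eq_bigr do rewrite evE.
rewrite evE exchange_big /=; apply: eq_bigr => w _.
by rewrite (big_morph Posz PoszD (erefl 0%:Z)) mulrz_suml.
Qed.

Lemma ev_ext F G z : F =1 G -> ev F z = ev G z.
Proof. by move=> FG; rewrite !evE; apply: eq_bigr => w _; rewrite FG. Qed.

Lemma pi_mapU k w :
  pi_map k << w >> = \sum_(u : W X k) << (hom_count (W_uword u) w)%:Z *g u >>.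
Proof. by rewrite /pi_map liftU scale1r. Qed.

Lemma ZC_autU phi w : ZC_aut phi << w >> = << cword_aut phi w >>.
Proof. by rewrite /ZC_aut liftU scale1r. Qed.

Lemma coeff_pi_mapU k (u : W X k) w :
  coeff u (pi_map k << w >>) = (hom_count (W_uword u) w)%:Z.
Proof.
rewrite pi_mapU raddf_sum (bigD1 u) //= coeffU eqxx mulr1 big1 ?addr0 // => u'.
by rewrite coeffU => /negPf ->; rewrite mulr0.
Qed.

Lemma pi_map_eq0 k z :
  pi_map k z = 0 <-> forall u : W X k, ev (hom_count (W_uword u)) z = 0.
Proof.
have E (u : W X k) : coeff u (pi_map k z) = ev (hom_count (W_uword u)) z.
  apply: (ZC_additive_eq (f := coeff u \o pi_map k) (g := ev _)) => w.
  by rewrite /= evU coeff_pi_mapU.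
split=> [z0 u|z0]; first by rewrite -E z0 coeff0.
by apply/eqP/freeg_eqP => u; rewrite E z0 coeff0.
Qed.

Lemma ev_ZC_aut phi F z : ev F (ZC_aut phi z) = ev (F \o cword_aut phi) z.
Proof.
apply: (ZC_additive_eq (f := ev F \o ZC_aut phi) (g := ev _)) => w.
by rewrite /= ZC_autU !evU.
Qed.

Lemma ulen_pi (s : folded_segment X) : ulen (\pi_(uword X) s) = size s.
Proof. exact: giso_segment_size (seg_iso_repr s). Qed.

(** Each occurrence of a word extends to one of each greater length, so the counts of
   words of length [m] determine those of shorter words. *)
Lemma pi_map_eq0_le m z (s : seq L) : pi_map m z = 0 -> s != [::] -> (size s <= m)%N ->
  ev (fun w => hc s (repr w)) z = 0.
Proof.
move=> z0; move En: (m - size s)%N => n; elim: n s En => [|n IHn] s En s0 sm.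
  have [sr|sr] := boolP (word_reduced s); last first.
    rewrite evE big1 // => w _; rewrite /hc.
    by rewrite !cocc_reduced ?cycred_winv ?circle_cycred ?mul0rz.
  have sF : (s != [::]) && folded (segment s) by rewrite s0 folded_segment_reduced.
  have len : ulen (\pi_(uword X) (FoldedSegment sF)) == m.
    by rewrite ulen_pi /= eqn_leq sm -subn_eq0 En.
  have /pi_map_eq0/(_ (UWordOfLen len)) := z0.
  by rewrite (ev_ext _ (hom_count_pi_seg (FoldedSegment sF))).
rewrite (ev_ext _ (fun w => hc_rcons s (repr w))) ev_sum big1 // => a _.
apply: IHn; rewrite ?size_rcons; [lia| by case: (s) | lia].
Qed.

Lemma ev_hom_count_eq0 m z (u : uword X) : pi_map m z = 0 -> (ulen u <= m)%N ->
  ev (hom_count u) z = 0.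
Proof.
move=> z0 um; rewrite (ev_ext _ (hom_countE u)); apply: pi_map_eq0_le z0 _ um.
by case: (uword_word u).
Qed.

Lemma tpi_eq0 k z : tpi k z = 0 <-> pi_map k z = 0.
Proof. by split=> [/(congr1 val) //|z0]; apply: val_inj. Qed.

Lemma tpi_le k m z : (k <= m)%N -> tpi m z = 0 -> tpi k z = 0.
Proof.
move=> km /tpi_eq0 z0; apply/tpi_eq0/pi_map_eq0 => u.
by apply: ev_hom_count_eq0 z0 _; rewrite (eqP (valP u)).
Qed.

(** Counts in the image of a cyclic word are sums of counts of words of length at
   most [max_len S k] in the word itself. *)
Lemma tpi_aut phi (S : uword X -> seq (uword X)) k m z :
  (forall u, counts_preimages phi u (S u)) -> (max_len S k <= m)%N ->
  tpi m z = 0 -> tpi k (ZC_aut phi z) = 0.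
Proof.
move=> HS km /tpi_eq0 z0; apply/tpi_eq0/pi_map_eq0 => u.
rewrite ev_ZC_aut (ev_ext _ (HS (W_uword u))) ev_sum big_seq big1 // => v vS.
apply: ev_hom_count_eq0 z0 _; apply: leq_trans km.
rewrite /max_len (bigD1 u) //= (leq_trans _ (leq_maxl _ _)) //.
by rewrite (big_rem v) //= leq_maxl.
Qed.

Lemma p_mapE k z : p_map X k (tpi k z) = tpi k.-1 z.
Proof.
move: z; apply: inducedP; apply: additive_factor; first exact: tpi_surj.
by move=> z; apply: tpi_le; apply: leq_pred.
Qed.

Lemma phi_mapE phi (S : uword X -> seq (uword X)) k z :
  (forall u, counts_preimages phi u (S u)) ->
  phi_map phi (max_len S k) k (tpi _ z) = tpi k (ZC_aut phi z).
Proof.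
move=> HS; move: z; apply: inducedP.
apply: (additive_factor (g := tpi k \o ZC_aut phi)); first exact: tpi_surj.
by move=> z; apply: tpi_aut.
Qed.

Lemma lim_comp_le (v : limM X) k m z : (k <= m)%N ->
  lim_comp v m = tpi m z -> lim_comp v k = tpi k z.
Proof.
move=> km vm; have: (k <= m)%N by []; elim: m {km} vm => [|m IHm] vm.
  by rewrite leqn0 => /eqP ->.
rewrite leq_eqVlt => /orP[/eqP -> //|]; rewrite ltnS; apply: IHm.
have /asboolP vp := valP v.
by have := vp m; rewrite -[val v m.+1]/(lim_comp v m.+1) vm p_mapE => ->.
Qed.

Lemma limP (v v' : limM X) : (forall k, lim_comp v k = lim_comp v' k) -> v = v'.
Proof. by move=> vv'; apply: val_inj; apply: functional_extensionality_dep. Qed.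

Lemma lim_of_compat z : compatible (fun k => tpi k z).
Proof. by apply/asboolP => k; rewrite p_mapE. Qed.

Definition lim_of z : limM X := LimM (lim_of_compat z).

Section Action.
Variable S : group_aut (free_group X) -> uword X -> seq (uword X).
Hypothesis HS : forall phi u, counts_preimages phi u (S phi u).

Definition act_seq phi (v : limM X) : tM_seq X :=
  fun k => phi_map phi (max_len (S phi) k) k (lim_comp v (max_len (S phi) k)).

Lemma act_seqE phi v k m z : (max_len (S phi) k <= m)%N ->
  lim_comp v m = tpi m z -> act_seq phi v k = tpi k (ZC_aut phi z).
Proof. by move=> km /(lim_comp_le km); rewrite /act_seq => ->; apply: phi_mapE. Qed.

Lemma act_compat phi v : compatible (act_seq phi v).
Proof.
apply/asboolP => k; pose m := maxn (max_len (S phi) k) (max_len (S phi) k.+1).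
have [z /esym zv] := tpi_surj (lim_comp v m).
by rewrite !(act_seqE _ zv) ?leq_maxl ?leq_maxr // p_mapE.
Qed.

Definition act phi (v : limM X) : limM X := LimM (act_compat phi v).

(** Any combination [z] of cyclic words that agrees with [v] at a level far enough
   may serve to compute the action, whatever this level is. *)
Lemma actE phi v k m z : (max_len (S phi) k <= m)%N ->
  lim_comp v m = tpi m z -> lim_comp (act phi v) k = tpi k (ZC_aut phi z).
Proof. exact: act_seqE. Qed.

Lemma act_lim_of phi z : act phi (lim_of z) = lim_of (ZC_aut phi z).
Proof. by apply: limP => k; apply: (actE (leqnn _)). Qed.

Lemma actD phi : {morph act phi : x y / x + y}.
Proof. by move=> x y; apply: limP => k; apply: raddfD. Qed.

Lemma actM phi psi v : act (phi * psi)%g v = act phi (act psi v).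
Proof.
apply: limP => k; set m := max_len (S phi) k.
pose n := maxn (max_len (S psi) m) (max_len (S (phi * psi)%g) k).
have [z /esym zv] := tpi_surj (lim_comp v n).
rewrite (actE _ zv) ?leq_maxr // (actE (leqnn _) (actE _ zv)) ?leq_maxl //.
congr (tpi k _).
apply: (ZC_additive_eq (f := ZC_aut (phi * psi)%g) (g := ZC_aut phi \o ZC_aut psi)).
by move=> w; rewrite /= !ZC_autU cword_autM.
Qed.

Lemma act_out phi psi v : out_class phi = out_class psi -> act phi v = act psi v.
Proof.
move=> E; apply: limP => k.
pose n := maxn (max_len (S phi) k) (max_len (S psi) k).
have [z /esym zv] := tpi_surj (lim_comp v n).
rewrite !(actE _ zv) ?leq_maxr ?leq_maxl //; congr (tpi k _).
by apply: ZC_additive_eq => w; rewrite /= !ZC_autU (cword_aut_out w E).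
Qed.

Lemma act1 v : act 1%g v = v.
Proof.
apply: limP => k.
pose n := maxn (max_len (S 1%g) k) k.
have [z /esym zv] := tpi_surj (lim_comp v n).
rewrite (actE _ zv) ?leq_maxl // (lim_comp_le (leq_maxr _ _) zv); congr (tpi k _).
by apply: (ZC_additive_eq (g := idfun)) => w; rewrite /= !ZC_autU cword_aut1.
Qed.

Lemma act_bij phi : bijective (act phi).
Proof.
by exists (act phi^-1%g) => v; rewrite -actM ?mulVg ?mulgV act1.
Qed.

Lemma act_aut phi : is_zmod_aut (mk_sym (act_bij phi)).
Proof. exact/asboolP/actD. Qed.

Definition zact phi : zmod_aut (limM X) := ZmodAut (act_aut phi).

Lemma act_eq phi psi : (forall v, act phi v = act psi v) ->
  forall w, cword_aut phi w = cword_aut psi w.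
Proof.
move=> E w; apply: cword_sep => u.
have := congr1 (fun v => lim_comp v (ulen u)) (E (lim_of << w >>)).
rewrite !act_lim_of !ZC_autU => /(congr1 val) /= Epi.
pose u' : W X (ulen u) := UWordOfLen (eqxx (ulen u)).
by have := congr1 (coeff u') Epi; rewrite !coeff_pi_mapU => -[].
Qed.

End Action.
End Limit.

(** The rank 1 is excluded because the inversion of [Z] fixes all cyclic words; in
   rank 0 the group is trivial. *)
Lemma out_class_eq (X : finType) (phi psi : group_aut (free_group X)) : #|X| <> 1%N ->
  (forall w, cword_aut phi w = cword_aut psi w) -> out_class phi = out_class psi.
Proof.
move=> X1 E; apply/out_classP.
have fixw w : cword_aut (phi * psi^-1)%g w = w.
  by rewrite cword_autM E -cword_autM mulgV cword_aut1.
have /cword_aut_fix cjphi := fixw.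
case: (ltngtP #|X| 1) => // [X0|/card_gt1P[x1 [x2 [_ _ x12]]]]; last first.
  exact: pointwise_inner x12 cjphi.
have triv (g : free_group X) : g = 1%g.
  apply: val_inj; case: (val g) => // -[x b] s.
  by move: X0; rewrite ltnS leqn0 => /eqP/card0_eq/(_ x).
by apply/asboolP; exists 1%g; apply: group_autP => g; rewrite [LHS]triv [RHS]triv.
Qed.

Theorem theorem3 (n : nat) (X : finType) (cardX : #|X| = n) (n_neq1 : n <> 1%N) :
  (forall (phi : group_aut (free_group X)) (u : uword X),
     exists s : seq (uword X), counts_preimages phi u s) /\
  (forall S : group_aut (free_group X) -> uword X -> seq (uword X),
     (forall phi u, counts_preimages phi u (S phi u)) ->
     exists rho : {multiplicative group_out (free_group X) -> zmod_aut (limM X)},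
       (forall (phi : group_aut (free_group X)) (v : limM X) (k : nat),
          lim_comp (rho (out_class phi) v) k =
          phi_map phi (max_len (S phi) k) k (lim_comp v (max_len (S phi) k))) /\
       injective rho).
Proof.
split=> [|S HS]; first exact: counts_preimages_ex.
pose r (a : group_out (free_group X)) : zmod_aut (limM X) := zact HS (repr a).
have rM : {morph r : a b / (a * b)%g}.
  move=> a b; apply/val_inj/symP => v.
  rewrite -[LHS]/(act HS (repr (a * b)%g) v).
  rewrite -[RHS]/(act HS (repr a) (act HS (repr b) v)) -actM.
  by apply: act_out; rewrite out_class_repr out_classM !out_class_repr.
pose rho : {multiplicative group_out (free_group X) -> zmod_aut (limM X)} :=
  HB.pack r (isMultiplicative.Build _ _ r rM).
exists rho; split=> [phi v k | a b ab].
  have -> : rho (out_class phi) v = act HS phi v; last by [].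
  exact/act_out/out_class_repr.
rewrite -(out_class_repr a) -(out_class_repr b); apply: out_class_eq.
  by rewrite cardX.
apply: (@act_eq _ S HS) => v.
exact: (congr1 (fun f : zmod_aut (limM X) => f v) ab).
Qed.
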